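(* Let $M$ be a compact $m$-dimensional submanifold of the unit sphere $\mathbb{S}^n$, with mean curvature $H$, and let $k$ be a real number. (i) If $m<k$, then $M$ is biharmonic of index $k$ in $\mathbb{S}^n$ if and only if $M$ is harmonic in $\mathbb{S}^n$. (ii) If $m\bigl(1-\inf_{p\in M}|H_p|^2\bigr)\le k<m$ and $M$ is pseudo-umbilical, then $M$ is properly biharmonic of index $k$ in $\mathbb{S}^n$ if and only if its mean curvature is parallel ($\nabla^N H=0$), of nonzero constant norm, and satisfies $k=m(1-|H|^2)$.
   Context: $\mathbb{S}^n$ carries its canonical metric and $M$ the induced metric $g$; $m=\dim M$. Compact means compact without boundary. $B$ is the second fundamental form of $M$ in $\mathbb{S}^n$, $A$ the Weingarten operator ($g(A_\xi X,Y)=\langle B(X,Y),\xi\rangle$), $H=\frac1m\operatorname{tr}B$ the mean curvature, $\nabla^N$ the connection on the normal bundle. $M$ is harmonic in $\mathbb{S}^n$ (its inclusion is a harmonic map) iff $H=0$. $M$ is pseudo-umbilical if $A_H=|H|^2\,\mathrm{Id}_{TM}$. With $i:M\to\mathbb{S}^n$ the inclusion and $\Delta=-\operatorname{tr}\nabla^2$ the (nonnegative) rough Laplacian on sections of $i^*T\mathbb{S}^n$ for the pulled-back Levi-Civita connection, $M$ is biharmonic of index $k$ in $\mathbb{S}^n$ if $(\Delta-m+k)H=0$; it is properly biharmonic of index $k$ if moreover $M$ is not harmonic ($H\not\equiv0$). *)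

(* Defs.v *)
From mathcomp Require Import all_boot all_order all_algebra.
From mathcomp Require Import all_classical all_reals all_analysis.

Set Implicit Arguments.
Unset Strict Implicit.
Unset Printing Implicit Defensive.

Import Order.TTheory GRing.Theory Num.Theory.
Import numFieldNormedType.Exports.

Local Open Scope classical_set_scope.
Local Open Scope ring_scope.

(* The norm `|v| of a row vector is the sup norm, so the Euclidean structure
   of R^N (hence the metrics of the sphere and of its submanifolds) is given
   by dot and enorm. The topology is the same. *)
Definition dot (R : realType) (N : nat) (u v : 'rV[R]_N) : R :=
  \sum_(i < N) u 0 i * v 0 i.

Definition enorm (R : realType) (N : nat) (v : 'rV[R]_N) : R :=
  Num.sqrt (dot v v).

Definition sphere (R : realType) (n : nat) : set 'rV[R]_n.+1 :=
  [set p | enorm p = 1].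

Fixpoint Ck_on (R : realType) (V W : normedModType R) (k : nat) (A : set V)
    (f : V -> W) : Prop :=
  if k is k'.+1
  then (forall x, A x -> differentiable f x) /\
       (forall v : V, Ck_on k' A (fun x => 'D_v f x))
  else forall x, A x -> {for x, continuous f}.

(* Meant for open A. *)
Definition smooth_on (R : realType) (V W : normedModType R) (A : set V)
    (f : V -> W) : Prop := forall k, Ck_on k A f.

(* phi is a diffeomorphism from the open set U of R^m onto the relatively open
   subset M `&` W of M, its inverse being the restriction of the smooth map x
   defined on the open set W of the ambient space (Milnor's notion of smooth
   parametrization of a subset of R^N). *)
Definition local_chart (R : realType) (N m : nat) (M : set 'rV[R]_N)
    (U : set 'rV[R]_m) (W : set 'rV[R]_N)
    (phi : 'rV[R]_m -> 'rV[R]_N) (x : 'rV[R]_N -> 'rV[R]_m) : Prop :=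
  [/\ open U, open W, smooth_on U phi, smooth_on W x
    & phi @` U = M `&` W /\ (forall u, U u -> x (phi u) = u)].

Definition submanifold (R : realType) (N m : nat) (M : set 'rV[R]_N) : Prop :=
  forall p, M p -> exists U W phi x, W p /\ @local_chart R N m M U W phi x.

(* Manifolds are nonempty. A subset of the sphere is an embedded submanifold
   of it iff it is an embedded submanifold of R^n.+1. *)
Definition compact_submanifold_of_sphere (R : realType) (n m : nat)
    (M : set 'rV[R]_n.+1) : Prop :=
  [/\ M !=set0, M `<=` @sphere R n, compact M & submanifold m M].

Section extrinsic_geometry.
Context (R : realType) (N m : nat) (M : set 'rV[R]_N).
Implicit Types (p X Y Z : 'rV[R]_N) (V : 'rV[R]_N -> 'rV[R]_N).

Definition tangent p : set 'rV[R]_N :=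
  [set X | exists U W phi x, [/\ W p, @local_chart R N m M U W phi x
                               & exists v, X = 'D_v phi (x p)]].

(* In the definitions below, vectors and vector fields live in R^N: a field
   along M is a map V from R^N to itself, of which only the values on M
   matter, and the arguments p and X are meant with M p and tangent p X. *)

(* phi \o x is a smooth map from a neighborhood of p to M that is the identity
   on M; V \o retraction p is thus a smooth extension of V near p as soon as V
   is smooth on M, and its derivative at p along a tangent vector does not
   depend on the extension. *)
Definition retraction p : 'rV[R]_N -> 'rV[R]_N :=
  get [set r | exists U W phi x,
         [/\ W p, @local_chart R N m M U W phi x & r = phi \o x]].

Definition flatD V p X : 'rV[R]_N := 'D_X (V \o retraction p) p.

Definition tangent_part p Y : 'rV[R]_N :=
  get [set Z | tangent p Z /\ forall X, tangent p X -> dot (Y - Z) X = 0].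

(* For Y tangent to the sphere at p. *)
Definition normal_part p Y : 'rV[R]_N := Y - tangent_part p Y.

Definition tangent_basis p : 'I_m -> 'rV[R]_N :=
  get [set e | (forall i, tangent p (e i)) /\
               (forall i j, dot (e i) (e j) = (i == j)%:R)].

(* Trace over the tangent space of M at p, for the induced metric. *)
Definition trace p (b : 'rV[R]_N -> 'rV[R]_N -> 'rV[R]_N) : 'rV[R]_N :=
  \sum_(i < m) b (tangent_basis p i) (tangent_basis p i).

(* Connection on the sections of i^*TS^n pulled back from the Levi-Civita
   connection of the unit sphere, which is the component tangent to the sphere
   (i.e. orthogonal to p) of the flat derivative. *)
Definition nablaS V p X : 'rV[R]_N :=
  flatD V p X - dot (flatD V p X) p *: p.

(* Levi-Civita connection of the induced metric, for V tangent to M. *)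
Definition nablaM V p X : 'rV[R]_N := tangent_part p (nablaS V p X).

(* For V normal to M in the sphere. *)
Definition nablaN V p X : 'rV[R]_N := normal_part p (nablaS V p X).

(* The tensorial expressions second_form and hessian below are evaluated by
   extending the tangent vector Y to this tangent vector field. *)
Definition extend Y : 'rV[R]_N -> 'rV[R]_N := fun q => tangent_part q Y.

Definition second_form p X Y : 'rV[R]_N :=
  normal_part p (nablaS (extend Y) p X).

Definition weingarten p (xi X : 'rV[R]_N) : 'rV[R]_N :=
  get [set Z | tangent p Z /\
         forall Y, tangent p Y -> dot Z Y = dot (second_form p X Y) xi].

Definition mean_curvature p : 'rV[R]_N :=
  m%:R^-1 *: trace p (second_form p).

Definition hessian V p X Y : 'rV[R]_N :=
  nablaS (fun q => nablaS V q (extend Y q)) p X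
  - nablaS V p (nablaM (extend Y) p X).

Definition rough_laplacian V p : 'rV[R]_N := - trace p (hessian V p).

(* second_form is nablaS (extend Y) p X - nablaM (extend Y) p X, the second
   derivative of the inclusion, so m times the mean curvature is the tension
   field of the inclusion. *)
Definition harmonic_submanifold : Prop := forall p, M p -> mean_curvature p = 0.

Definition pseudo_umbilical : Prop :=
  forall p X, M p -> tangent p X ->
    weingarten p (mean_curvature p) X = enorm (mean_curvature p) ^+ 2 *: X.

Definition biharmonic_submanifold (k : R) : Prop :=
  forall p, M p ->
    rough_laplacian mean_curvature p - m%:R *: mean_curvature p
      + k *: mean_curvature p = 0.

Definition properly_biharmonic_submanifold (k : R) : Prop :=
  biharmonic_submanifold k /\ ~ harmonic_submanifold.

Definition parallel_mean_curvature : Prop :=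
  forall p X, M p -> tangent p X -> nablaN mean_curvature p X = 0.

End extrinsic_geometry.

Arguments tangent {R N} m M p.
Arguments mean_curvature {R N} m M p.
Arguments harmonic_submanifold {R N} m M.
Arguments pseudo_umbilical {R N} m M.
Arguments biharmonic_submanifold {R N} m M k.
Arguments properly_biharmonic_submanifold {R N} m M k.
Arguments parallel_mean_curvature {R N} m M.

(* Main.v *)
Require Import Defs.
From mathcomp Require Import all_boot all_order all_algebra.
From mathcomp Require Import all_classical all_reals all_analysis.
Set Implicit Arguments.
Unset Strict Implicit.
Unset Printing Implicit Defensive.
Import Order.TTheory GRing.Theory Num.Theory.
Import numFieldNormedType.Exports.
Local Open Scope classical_set_scope.
Local Open Scope ring_scope.

(** The proof is a maximum principle for the function |H|^2 on M; it replaces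
    the integrations by parts over M that one would otherwise perform.

    At a point p where |H|^2 is maximal, the second derivative of |H|^2 along
    any tangent vector Y is nonpositive, i.e. the scalar product of the Hessian
    of H at (Y, Y) with H is at most - |nabla_Y H|^2 ([hessian_max]). Summing
    over an orthonormal basis e_i of the tangent space,
      sum_i |nabla_{e_i} H|^2 <= <Delta H, H>   at p   ([laplacian_at_max]),
    and <Delta H, H> = (m - k) |H|^2 when M is biharmonic of index k.

    If m < k, the right-hand side is nonpositive, so |H|^2 <= 0 at its maximum,
    and H vanishes everywhere.

    In the pseudo-umbilical case nabla_X H splits orthogonally as
    - |H|^2 X + nabla^N_X H, so at a maximum
      m |H|^4 + sum_i |nabla^N_{e_i} H|^2 <= (m - k) |H|^2.
    As H is not identically zero, m max |H|^2 <= m - k, whereas the hypothesis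
    on k says m - k <= m inf |H|^2. Hence |H|^2 is the constant (m - k) / m,
    every point of M is a maximum, and the normal terms vanish. Conversely, if
    H is parallel of constant norm c and M is pseudo-umbilical, then
    nabla_X H = - c^2 X, whose derivative gives Delta H = c^2 tr B = m c^2 H;
    this is (m - k) H for the stated k ([rough_laplacian_scalar]).

    All local computations take place in a chart phi with Jacobian matrix J
    (row vectors act on the left, the rows of J are the partial derivatives of
    phi). The tangential projection is P = J^T (J J^T)^-1 J, and every object
    of the geometry is a smooth matrix expression in phi, J, P and their
    derivatives: with X = v J, the second fundamental form at (X, Y) is
    Y (D_v P) Q, where Q projects onto the normal space in the sphere
    ([second_formE], [mean_curvatureE]). *)

(** * Smooth functions on an open set *)

Section NearEqual.
Context (R : realType) (V W : normedModType R).

Lemma near_eq_diff_locally (f g : V -> W) (x : V) :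
  (\forall y \near x, f y = g y) -> differentiable f x ->
  g \o shift x = cst (g x) + 'd f x +o_ (0 : V) id.
Proof.
move=> fg df; have /diff_locallyP [_ dfo] := df.
apply: eqaddoE; apply/eqaddoP => e e0.
have /eqaddoP/(_ e e0) := dfo.
have fg0 : \forall y \near (0 : V), f (y + x) = g (y + x).
  by move: fg; rewrite (near_shift 0) subr0.
apply: filterS2 fg0 => y /= fgy.
by rewrite /= !fctE /= /cst (nbhs_singleton fg) fgy.
Qed.

Lemma near_eq_differentiable (f g : V -> W) (x : V) :
  (\forall y \near x, f y = g y) -> differentiable f x -> differentiable g x.
Proof.
move=> fg df; apply/diff_locallyP.
have dg : 'd g x = 'd f x :> (V -> W).
  apply: diff_unique; first exact: diff_continuous.
  exact: near_eq_diff_locally.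
rewrite dg; split; first exact: diff_continuous.
exact: near_eq_diff_locally.
Qed.

End NearEqual.

Section SmoothFunctions.
Context (R : realType) (V : normedModType R) (A : set V) (oA : open A).

Lemma near_open_set (x : V) : A x -> \forall y \near x, A y.
Proof. by move=> Ax; apply: open_nbhs_nbhs. Qed.

Lemma eq_on_near (T : Type) (f g : V -> T) (x : V) :
  A x -> (forall y, A y -> f y = g y) -> \forall y \near x, f y = g y.
Proof. by move=> Ax fg; apply: filterS (near_open_set Ax) => y; apply: fg. Qed.

Lemma eq_on_derive (W : normedModType R) (f g : V -> W) (x v : V) :
  A x -> (forall y, A y -> f y = g y) -> 'D_v f x = 'D_v g x.
Proof. by move=> Ax fg; apply: near_eq_derive; apply: eq_on_near. Qed.

Lemma Ck_on_ext (W : normedModType R) k (f g : V -> W) :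
  (forall y, A y -> f y = g y) -> Ck_on k A f -> Ck_on k A g.
Proof.
elim: k f g => [|k IH] f g fg /=.
  move=> cf x Ax; have cfx := cf x Ax.
  rewrite /prop_for /continuous_at -(fg x Ax).
  apply: cvg_trans cfx; apply: near_eq_cvg.
  by apply: eq_on_near => // y Ay; rewrite fg.
move=> [df cdf]; split.
  move=> x Ax; apply: near_eq_differentiable (df x Ax).
  exact: eq_on_near.
by move=> v; apply: IH (cdf v) => y Ay; apply: eq_on_derive.
Qed.

(** Smoothness is a coinductive notion: a class of functions differentiable on
    the open set and stable under directional derivatives, up to equality on
    the set, consists of smooth functions. *)
Lemma smooth_on_coind (W : normedModType R) (S : set (V -> W)) :
  (forall f x, S f -> A x -> differentiable f x) ->
  (forall f v, S f -> exists2 g, S g & forall x, A x -> 'D_v f x = g x) ->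
  forall f, S f -> smooth_on A f.
Proof.
move=> Sd SD f Sf k; elim: k f Sf => [|k IH] f Sf /=.
  by move=> x Ax; apply: differentiable_continuous; apply: Sd.
split; first by move=> x; apply: Sd.
move=> v; have [g Sg fg] := SD f v Sf.
by apply: Ck_on_ext (IH g Sg) => y Ay; rewrite fg.
Qed.

Lemma smooth_differentiable (W : normedModType R) (f : V -> W) x :
  smooth_on A f -> A x -> differentiable f x.
Proof. by move=> /(_ 1%N) [df _]; apply: df. Qed.

Lemma smooth_derive (W : normedModType R) (f : V -> W) v :
  smooth_on A f -> smooth_on A (fun x => 'D_v f x).
Proof. by move=> sf k; have [_] := sf k.+1; apply. Qed.

(** The functions obtained from smooth ones by sums, products and inverses. The
    product and quotient rules do not leave this class, so that
    [smooth_on_coind] proves all its members smooth at once ([smalgP]), without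
    a Leibniz formula for iterated derivatives. *)
Inductive smalg : (V -> R) -> Prop :=
| smalg_smooth f : smooth_on A f -> smalg f
| smalg_add f g : smalg f -> smalg g -> smalg (f \+ g)
| smalg_mul f g : smalg f -> smalg g -> smalg (f \* g)
| smalg_inv f : (forall x, A x -> f x != 0) -> smalg f ->
    smalg (fun x => (f x)^-1).

Lemma smalg_differentiable f x : smalg f -> A x -> differentiable f x.
Proof.
move=> sf Ax; elim: sf => {f} [f|f g _ df _ dg|f g _ df _ dg|f f0 _ df].
- by move/smooth_differentiable; apply.
- exact: differentiableD.
- exact: differentiableM.
- by apply: differentiableV => //; apply: f0.
Qed.

Lemma smooth_cst (W : normedModType R) (c : W) : smooth_on A (fun=> c).
Proof.
apply: (@smooth_on_coind _ [set f | exists c, f = cst c]); last by exists c.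
- by move=> f x [d ->] _; apply: differentiable_cst.
- by move=> f v [d ->]; exists (cst 0); [exists 0 | move=> x _; rewrite derive_cst].
Qed.

Lemma smalg_derive f v : smalg f ->
  exists2 g, smalg g & forall x, A x -> 'D_v f x = g x.
Proof.
have der g : smalg g -> forall x, A x -> derivable g x v.
  by move=> sg x Ax; apply: diff_derivable; apply: smalg_differentiable.
elim=> {f} [f sf|f g sf [f' sf' ff'] sg [g' sg' gg']
  |f g sf [f' sf' ff'] sg [g' sg' gg']|f f0 sf [f' sf' ff']].
- by exists (fun x => 'D_v f x) => //; apply/smalg_smooth/smooth_derive.
- exists (f' \+ g'); first exact: smalg_add.
  by move=> x Ax; rewrite deriveD ?ff' ?gg' //; apply: der.
- exists ((f \* g') \+ (g \* f')).
    by apply: smalg_add; apply: smalg_mul.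
  by move=> x Ax; rewrite deriveM ?ff' ?gg' //; apply: der.
- have sfV : smalg (fun x => (f x)^-1) by apply: smalg_inv.
  exists ((fun=> - 1) \* (((fun x => (f x)^-1) \* (fun x => (f x)^-1)) \* f')).
    apply: smalg_mul; first by apply/smalg_smooth/smooth_cst.
    by do 2?apply: smalg_mul.
  move=> x Ax; rewrite deriveV ?ff' //; [|exact: f0|exact: der].
  by rewrite /= mulN1r scaleNr expr2 invfM.
Qed.

Lemma smalgP f : smalg f -> smooth_on A f.
Proof.
by apply: smooth_on_coind => [g x|g v]; [exact: smalg_differentiable
  |exact: smalg_derive].
Qed.

Lemma smoothD (f g : V -> R) : smooth_on A f -> smooth_on A g ->
  smooth_on A (fun x => f x + g x).
Proof. by move=> sf sg; apply/smalgP/smalg_add; apply: smalg_smooth. Qed.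

Lemma smoothM (f g : V -> R) : smooth_on A f -> smooth_on A g ->
  smooth_on A (fun x => f x * g x).
Proof. by move=> sf sg; apply/smalgP/smalg_mul; apply: smalg_smooth. Qed.

Lemma smoothV (f : V -> R) : (forall x, A x -> f x != 0) -> smooth_on A f ->
  smooth_on A (fun x => (f x)^-1).
Proof. by move=> f0 sf; apply/smalgP/smalg_inv => //; apply: smalg_smooth. Qed.

Lemma smooth_sum (I : Type) (r : seq I) (P : pred I) (f : I -> V -> R) :
  (forall i, P i -> smooth_on A (f i)) ->
  smooth_on A (fun x => \sum_(i <- r | P i) f i x).
Proof.
move=> sf; elim: r => [|i r IH].
  under eq_fun do rewrite big_nil; exact: smooth_cst.
case Pi : (P i); last by under eq_fun do rewrite big_cons Pi.
under eq_fun do rewrite big_cons Pi.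
by apply: smoothD => //; apply: sf.
Qed.

Lemma smooth_prod (I : Type) (r : seq I) (P : pred I) (f : I -> V -> R) :
  (forall i, P i -> smooth_on A (f i)) ->
  smooth_on A (fun x => \prod_(i <- r | P i) f i x).
Proof.
move=> sf; elim: r => [|i r IH].
  under eq_fun do rewrite big_nil; exact: smooth_cst.
case Pi : (P i); last by under eq_fun do rewrite big_cons Pi.
under eq_fun do rewrite big_cons Pi.
by apply: smoothM => //; apply: sf.
Qed.

End SmoothFunctions.

(** * Directional derivatives and smooth matrix-valued maps *)

Section DirectionalDerivatives.
Context (R : realType) (V W : normedModType R).

Lemma derive_comp (U : normedModType R) (f : U -> V) (g : V -> W) (x v : U) :
  differentiable f x -> differentiable g (f x) ->
  'D_v (g \o f) x = 'D_('D_v f x) g (f x).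
Proof.
move=> df dg; rewrite !deriveE //; last exact: differentiable_comp.
by rewrite diff_comp.
Qed.

End DirectionalDerivatives.

Lemma derive_dir_rowE (R : realType) (m : nat) (W : normedModType R)
    (f : 'rV[R]_m -> W) (x v : 'rV[R]_m) :
  differentiable f x ->
  'D_v f x = \sum_(i < m) v 0 i *: 'D_(delta_mx 0 i) f x.
Proof.
move=> df; rewrite deriveE // {1}[v]row_sum_delta linear_sum.
by apply: eq_bigr => i _; rewrite deriveE // linearZ.
Qed.

Section MatrixDerivatives.
Context (R : realType) (V : normedModType R).

Lemma derive_mx_entry (a b : nat) (F : V -> 'M[R]_(a, b)) x v i j :
  derivable F x v -> ('D_v F x) i j = 'D_v (fun y => F y i j) x.
Proof. by move=> dF; rewrite derive_mx // mxE. Qed.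

Lemma derive_mulmx (a b c : nat) (F : V -> 'M[R]_(a, b))
    (G : V -> 'M[R]_(b, c)) x v : derivable F x v -> derivable G x v ->
  'D_v (fun y => F y *m G y) x = 'D_v F x *m G x + F x *m 'D_v G x.
Proof.
move=> dF dG.
have dFe i j : derivable (fun y => F y i j) x v.
  by move/derivable_mxP : dF; apply.
have dGe i j : derivable (fun y => G y i j) x v.
  by move/derivable_mxP : dG; apply.
have entryE i j : (fun y => (F y *m G y) i j) =
    \sum_(k < b) ((fun y => F y i k) \* (fun y => G y k j)).
  by apply/funext => y; rewrite mxE fct_sumE.
have dP i j k : derivable ((fun y => F y i k) \* (fun y => G y k j)) x v.
  exact: derivableM.
have dFG : derivable (fun y => F y *m G y) x v.
  apply/derivable_mxP => i j; rewrite entryE; exact: derivable_sum.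
apply/matrixP => i j; rewrite derive_mx_entry // entryE derive_sum // !mxE.
rewrite -big_split; apply: eq_bigr => k _ /=.
have -> := deriveM (dFe i k) (dGe k j).
by rewrite -!derive_mx_entry // addrC [_ *: ('D_v F x) i k]mulrC.
Qed.

Lemma derive_trmx (a b : nat) (F : V -> 'M[R]_(a, b)) x v :
  derivable F x v -> 'D_v (fun y => (F y)^T) x = ('D_v F x)^T.
Proof.
move=> dF.
have entryE i j : (fun y => (F y)^T i j) = (fun y => F y j i).
  by apply/funext => y; rewrite mxE.
apply/matrixP => i j; rewrite derive_mx_entry; last first.
  by apply/derivable_mxP => i' j'; rewrite entryE; move/derivable_mxP : dF; apply.
by rewrite entryE -derive_mx_entry // mxE.
Qed.

End MatrixDerivatives.

Section SmoothMatrices.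
Context (R : realType) (V : normedModType R) (A : set V) (oA : open A).

(** Entrywise smoothness reduces matrix expressions, determinants and inverses
    included, to the algebra of smooth scalar functions. *)
Definition smooth_mx (a b : nat) (F : V -> 'M[R]_(a, b)) : Prop :=
  forall i j, smooth_on A (fun x => F x i j).

Lemma smooth_mx_differentiable (a b : nat) (F : V -> 'M[R]_(a, b)) x :
  smooth_mx F -> A x -> differentiable F x.
Proof.
move=> sF Ax.
have -> : F = \sum_(i < a) \sum_(j < b) (fun y => F y i j *: delta_mx i j).
  apply/funext => y; rewrite {1}[F y]matrix_sum_delta fct_sumE.
  by apply: eq_bigr => i _; rewrite fct_sumE.
apply: differentiable_sum => i; apply: differentiable_sum => j.
by apply: differentiableZl; apply: smooth_differentiable (sF i j) _.
Qed.

Lemma smooth_mx_derivable (a b : nat) (F : V -> 'M[R]_(a, b)) x v :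
  smooth_mx F -> A x -> derivable F x v.
Proof. by move=> sF Ax; apply/diff_derivable/smooth_mx_differentiable. Qed.

Lemma smooth_on_mx (a b : nat) (F : V -> 'M[R]_(a, b)) :
  smooth_on A F -> smooth_mx F.
Proof.
move=> sF i j; pose S : set (V -> R) :=
  [set f | exists2 G : V -> 'M[R]_(a, b), smooth_on A G & f = fun x => G x i j].
apply: (smooth_on_coind oA (S := S)) => [f x [G sG ->] Ax|f v [G sG ->]|].
- apply: (differentiable_comp (g := fun M : 'M[R]_(a, b) => M i j)).
    exact: smooth_differentiable sG Ax.
  exact: differentiable_coord.
- exists (fun x => ('D_v G x) i j).
    by exists (fun x => 'D_v G x) => //; apply: smooth_derive.
  move=> x Ax; rewrite derive_mx_entry //.
  by apply/diff_derivable/smooth_differentiable/Ax.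
- by exists F.
Qed.

Lemma smooth_mx_derive (a b : nat) (F : V -> 'M[R]_(a, b)) v :
  smooth_mx F -> smooth_mx (fun x => 'D_v F x).
Proof.
move=> sF i j k.
apply: (Ck_on_ext oA) (smooth_derive v (sF i j) k) => x Ax.
by rewrite derive_mx_entry //; apply: smooth_mx_derivable.
Qed.

Lemma smooth_mx_cst (a b : nat) (C : 'M[R]_(a, b)) : smooth_mx (fun=> C).
Proof. by move=> i j; apply: (smooth_cst oA). Qed.

Lemma smooth_mxD (a b : nat) (F G : V -> 'M[R]_(a, b)) :
  smooth_mx F -> smooth_mx G -> smooth_mx (fun x => F x + G x).
Proof.
by move=> sF sG i j; under eq_fun do rewrite mxE; apply: (smoothD oA).
Qed.

Lemma smooth_mxM (a b c : nat) (F : V -> 'M[R]_(a, b)) (G : V -> 'M[R]_(b, c)) :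
  smooth_mx F -> smooth_mx G -> smooth_mx (fun x => F x *m G x).
Proof.
move=> sF sG i j; under eq_fun do rewrite mxE.
by apply: (smooth_sum oA) => k _; apply: (smoothM oA).
Qed.

Lemma smooth_mxN (a b : nat) (F : V -> 'M[R]_(a, b)) :
  smooth_mx F -> smooth_mx (fun x => - F x).
Proof.
move=> sF i j; under eq_fun do rewrite mxE -mulN1r.
by apply: (smoothM oA) => //; apply: (smooth_cst oA).
Qed.

Lemma smooth_mxB (a b : nat) (F G : V -> 'M[R]_(a, b)) :
  smooth_mx F -> smooth_mx G -> smooth_mx (fun x => F x - G x).
Proof. by move=> sF sG; apply: smooth_mxD => //; apply: smooth_mxN. Qed.

Lemma smooth_mx_scale (a b : nat) (f : V -> R) (F : V -> 'M[R]_(a, b)) :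
  smooth_on A f -> smooth_mx F -> smooth_mx (fun x => f x *: F x).
Proof.
by move=> sf sF i j; under eq_fun do rewrite mxE; apply: (smoothM oA).
Qed.

Lemma smooth_mx_sum (I : Type) (r : seq I) (P : pred I) (a b : nat)
    (F : I -> V -> 'M[R]_(a, b)) :
  (forall i, P i -> smooth_mx (F i)) ->
  smooth_mx (fun x => \sum_(i <- r | P i) F i x).
Proof.
move=> sF i j; under eq_fun do rewrite summxE.
by apply: (smooth_sum oA) => k Pk; apply: sF.
Qed.

Lemma smooth_mxT (a b : nat) (F : V -> 'M[R]_(a, b)) :
  smooth_mx F -> smooth_mx (fun x => (F x)^T).
Proof. by move=> sF i j; under eq_fun do rewrite mxE; apply: sF. Qed.

Lemma smooth_det (a : nat) (F : V -> 'M[R]_a) :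
  smooth_mx F -> smooth_on A (fun x => \det (F x)).
Proof.
move=> sF; rewrite /determinant; apply: (smooth_sum oA) => s _.
apply: (smoothM oA); first exact: (smooth_cst oA).
by apply: (smooth_prod oA) => i _; apply: sF.
Qed.

Lemma smooth_mxV (a : nat) (F : V -> 'M[R]_a) :
  (forall x, A x -> F x \in unitmx) -> smooth_mx F ->
  smooth_mx (fun x => invmx (F x)).
Proof.
move=> uF sF i j.
have sdet : smooth_on A (fun x => (\det (F x))^-1).
  apply: (smoothV oA); last exact: smooth_det.
  by move=> x /uF; rewrite unitmxE unitfE.
move=> k; apply: (Ck_on_ext oA (f := fun x => (\det (F x))^-1 * cofactor (F x) j i)).
  by move=> x /uF uFx; rewrite /invmx uFx !mxE.
move: k; apply: (smoothM oA) => //; rewrite /cofactor.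
apply: (smoothM oA); first exact: (smooth_cst oA).
by apply: smooth_det => i' j'; under eq_fun do rewrite !mxE; apply: sF.
Qed.

End SmoothMatrices.

(** * Euclidean product and orthonormal bases *)

Section EuclideanProduct.
Context (R : realType) (N : nat).
Implicit Types (u v w : 'rV[R]_N) (a : R).

Lemma dotE u v : dot u v = (u *m v^T) 0 0.
Proof. by rewrite /dot mxE; apply: eq_bigr => i _; rewrite mxE. Qed.

Lemma dotC u v : dot u v = dot v u.
Proof. by apply: eq_bigr => i _; rewrite mulrC. Qed.

Lemma dotDl u v w : dot (u + v) w = dot u w + dot v w.
Proof. by rewrite !dotE mulmxDl mxE. Qed.

Lemma dotNl u w : dot (- u) w = - dot u w.
Proof. by rewrite !dotE mulNmx mxE. Qed.

Lemma dotBl u v w : dot (u - v) w = dot u w - dot v w.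
Proof. by rewrite dotDl dotNl. Qed.

Lemma dotZl a u w : dot (a *: u) w = a * dot u w.
Proof. by rewrite !dotE -scalemxAl mxE. Qed.

Lemma dot0l w : dot 0 w = 0.
Proof. by rewrite dotE mul0mx mxE. Qed.

Lemma dot_suml (I : Type) (r : seq I) (P : pred I) (F : I -> 'rV[R]_N) w :
  dot (\sum_(i <- r | P i) F i) w = \sum_(i <- r | P i) dot (F i) w.
Proof.
by rewrite dotE mulmx_suml summxE; apply: eq_bigr => i _; rewrite dotE.
Qed.

Lemma dotDr u v w : dot w (u + v) = dot w u + dot w v.
Proof. by rewrite !(dotC w) dotDl. Qed.

Lemma dotNr u w : dot w (- u) = - dot w u.
Proof. by rewrite !(dotC w) dotNl. Qed.

Lemma dotBr u v w : dot w (u - v) = dot w u - dot w v.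
Proof. by rewrite dotDr dotNr. Qed.

Lemma dotZr a u w : dot w (a *: u) = a * dot w u.
Proof. by rewrite !(dotC w) dotZl. Qed.

Lemma dot_mulmxl (M : 'M[R]_N) u v : dot (u *m M) v = dot u (v *m M^T).
Proof. by rewrite !dotE trmx_mul trmxK mulmxA. Qed.

Lemma dot_ge0 u : 0 <= dot u u.
Proof. by apply: sumr_ge0 => i _; rewrite -expr2 sqr_ge0. Qed.

Lemma dot_eq0 u : dot u u = 0 -> u = 0.
Proof.
move=> /eqP; rewrite psumr_eq0; last by move=> i _; rewrite -expr2 sqr_ge0.
move/allP => u0; apply/rowP => i; rewrite mxE; apply/eqP.
by have := u0 i (mem_index_enum i); rewrite -expr2 sqrf_eq0.
Qed.

Lemma sqr_enorm u : enorm u ^+ 2 = dot u u.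
Proof. by rewrite sqr_sqrtr // dot_ge0. Qed.

Lemma enorm_eq0 u : enorm u = 0 -> u = 0.
Proof. by move=> u0; apply: dot_eq0; rewrite -sqr_enorm u0 expr0n. Qed.

Lemma gram_unitmx (m : nat) (J : 'M[R]_(m, N)) :
  row_free J -> J *m J^T \in unitmx.
Proof.
move=> fJ; rewrite -row_free_unit -kermx_eq0; apply/rowV0P => v /sub_kermxP vG.
have vJ : v *m J = 0.
  by apply: dot_eq0; rewrite dotE trmx_mul mulmxA -(mulmxA v) vG mul0mx mxE.
by apply/eqP; rewrite -(mulmx_free_eq0 v fJ) vJ.
Qed.

(** Gram-Schmidt by counting dimensions: as long as fewer than m orthonormal
    vectors have been found, some nonzero vector of the row space of J is
    orthogonal to all of them. *)
Lemma orthonormal_rows (m : nat) (J : 'M[R]_(m, N)) : row_free J ->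
  exists E : 'M[R]_(m, N), E *m E^T = 1%:M /\ (E <= J)%MS.
Proof.
move=> fJ.
suff H (k : nat) : (k <= m)%N ->
    exists E : 'M[R]_(k, N), E *m E^T = 1%:M /\ (E <= J)%MS by exact: (H m (leqnn m)).
elim: k => [_|k IH km]; first by exists 0; rewrite sub0mx; split => //; apply/matrixP => -[].
have [E [EE EJ]] := IH (ltnW km).
have : kermx (J *m E^T) != 0.
  rewrite kermx_eq0 /row_free; apply: contraTneq km => rk.
  by rewrite -leqNgt -rk rank_leq_col.
move=> /rowV0Pn [v /sub_kermxP vJE v0].
have w0 : v *m J != 0 by rewrite mulmx_free_eq0.
pose e := (enorm (v *m J))^-1 *: (v *m J).
have n0 : enorm (v *m J) != 0 by apply: contraNneq w0 => /enorm_eq0 ->.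
have eE : e *m E^T = 0 by rewrite -scalemxAl -mulmxA vJE scaler0.
suff : col_mx e E *m (col_mx e E)^T = 1%:M /\ (col_mx e E <= J)%MS.
  by exists (col_mx e E).
split; last first.
  by rewrite col_mx_sub EJ andbT scalemx_sub // submxMl.
rewrite tr_col_mx mul_col_row EE eE.
have -> : E *m e^T = 0 by rewrite -[RHS]trmx0 -eE trmx_mul trmxK.
have -> : e *m e^T = 1%:M.
  apply/matrixP => i j; rewrite !ord1 -dotE dotZl dotZr -sqr_enorm mxE eqxx.
  by rewrite expr2 mulKf // mulVf.
by rewrite -scalar_mx_block.
Qed.

End EuclideanProduct.

Lemma derive_dot (R : realType) (N : nat) (V : normedModType R)
    (f g : V -> 'rV[R]_N) (x v : V) : derivable f x v -> derivable g x v ->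
  'D_v (fun y => dot (f y) (g y)) x = dot ('D_v f x) (g x) + dot (f x) ('D_v g x).
Proof.
move=> df dg.
have dgT : derivable (fun y => (g y)^T) x v.
  apply/derivable_mxP => i j; under eq_fun do rewrite mxE.
  by move/derivable_mxP : dg; apply.
have dfg : derivable (fun y => f y *m (g y)^T) x v.
  apply/derivable_mxP => i j.
  have -> : (fun y => (f y *m (g y)^T) i j) =
      \sum_(k < N) ((fun y => f y i k) \* (fun y => g y j k)).
    by apply/funext => y; rewrite mxE fct_sumE; apply: eq_bigr => k _; rewrite mxE.
  apply: derivable_sum => k; apply: derivableM.
    by move/derivable_mxP : df; apply.
  by move/derivable_mxP : dg; apply.
have -> : (fun y => dot (f y) (g y)) = (fun y => (f y *m (g y)^T) 0 0).
  by apply/funext => y; rewrite dotE.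
by rewrite -derive_mx_entry // derive_mulmx // derive_trmx // mxE -!dotE.
Qed.

(** * Second derivative test *)

Section SecondDerivativeTest.
Context (R : realType) (V : normedModType R).

Lemma derive_line (f : V -> R) (x v : V) (t : R) :
  derivable f (t *: v + x) v ->
  is_derive t 1 (fun s : R => f (s *: v + x)) ('D_v f (t *: v + x)).
Proof.
move=> df.
have E : (fun h : R => h^-1 *: (f ((h *: 1 + t) *: v + x) - f (t *: v + x))) =
         (fun h : R => h^-1 *: (f (h *: v + (t *: v + x)) - f (t *: v + x))).
  by apply/funext => h; rewrite scalerDl addrA [h *: 1]mulr1.
by split; rewrite /derivable /derive /= E.
Qed.

(** On the line through x directed by v, a positive second derivative would make
    the first derivative positive just after x, and the mean value theorem would
    then produce values larger than f x. *)
Lemma local_max_derive (f : V -> R) (x v : V) :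
  (\forall y \near x, derivable f y v) ->
  derivable (fun y => 'D_v f y) x v ->
  (\forall y \near x, f y <= f x) ->
  'D_v f x = 0 /\ 'D_v (fun y => 'D_v f y) x <= 0.
Proof.
move=> df ddf fmax.
have line : (fun t : R => t *: v + x) @ 0 --> x.
  have : (fun t : R => t *: v + x) @ 0 --> 0 *: v + x.
    apply: cvgD; last exact: cvg_cst.
    by apply: cvgZr_tmp; apply: cvg_id.
  by rewrite scale0r add0r.
have /nbhs_ballP [e /= e0 eP] : \forall t \near (0 : R),
    derivable f (t *: v + x) v /\ f (t *: v + x) <= f x.
  apply: (line (fun y => derivable f y v /\ f y <= f x)).
  by apply: filterS2 df fmax => y.
have lineP t : t \in `]- e, e[ ->
    is_derive t 1 (fun s : R => f (s *: v + x)) ('D_v f (t *: v + x)) /\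
    f (t *: v + x) <= f x.
  rewrite in_itv /= => te; have [|dft ft] := eP t.
    by rewrite /ball /= sub0r normrN ltr_norml.
  split; [exact: derive_line|exact: ft].
have D0 : 'D_v f x = 0.
  have ee0 : 0 \in `]- e, e[ by rewrite in_itv /= oppr_lt0 e0.
  have [dl _] := lineP 0 ee0.
  have [] := @derive1_at_max R (fun t => f (t *: v + x)) (- e) e 0 _ _ ee0 _.
  - by rewrite ge0_cp ?ltW.
  - by move=> t /lineP [[]].
  - by move=> t /lineP [_]; rewrite scale0r add0r.
  by move: dl => [_ ->] _; rewrite scale0r add0r.
split=> //; rewrite leNgt; apply/negP => D2.
have /nbhs_ballP [d /= d0 dP] : \forall h \near (0 : R),
    h != 0 -> 0 < h^-1 *: ('D_v f (h *: v + x) - 'D_v f x).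
  exact: (cvgr_gt _ ddf _ D2).
pose t := Num.min d e / 2.
have t0 : 0 < t by rewrite divr_gt0 // lt_min d0.
have td s : 0 < s < t -> s < d /\ s < e.
  move=> /andP [_ st]; apply/andP; rewrite -lt_min (lt_trans st) //.
  by rewrite ltr_pdivrMr // ltr_pMr ?ltr1n // lt_min d0.
have te s : s \in `[0, t] -> s \in `]- e, e[.
  rewrite !in_itv /= => /andP [s0 st].
  rewrite (lt_le_trans _ s0) ?oppr_lt0 //= (le_lt_trans st) //.
  rewrite ltr_pdivrMr // (@le_lt_trans _ _ e) ?ge_min ?lexx ?orbT //.
  by rewrite ltr_pMr ?ltr1n.
have [||c c0t] := @MVT R (fun s => f (s *: v + x))
  (fun s => 'D_v f (s *: v + x)) 0 t t0.
- move=> s s0t; apply: (lineP s _).1; apply: te.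
  exact: subset_itv_oo_cc s0t.
- apply: derivable_within_continuous => s s0t.
  by have [[]] := lineP s (te s s0t).
rewrite scale0r add0r subr0.
have /lineP [_ ft] : t \in `]- e, e[ by apply: te; rewrite in_itv /= lexx ltW.
apply/eqP; rewrite lt_eqF // (@le_lt_trans _ _ 0) ?subr_le0 // mulr_gt0 //.
move: c0t; rewrite in_itv /= => c0t; have [cd _] := td c c0t.
have /andP [c0 _] := c0t.
have := dP c; rewrite /= D0 subr0 -ball_normE /= sub0r normrN gtr0_norm //.
move=> /(_ cd (lt0r_neq0 c0)).
by rewrite pmulr_rgt0 // invr_gt0.
Qed.

End SecondDerivativeTest.

(** * Charts, tangent spaces and the flat derivative *)

Section Charts.
Context (R : realType) (N m : nat) (M : set 'rV[R]_N).

Definition jac (a : nat) (f : 'rV[R]_a -> 'rV[R]_N) (u : 'rV[R]_a) : 'M[R]_(a, N) :=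
  \matrix_(i < a) 'D_(delta_mx 0 i) f u.

Lemma derive_jac (a : nat) (f : 'rV[R]_a -> 'rV[R]_N) (u v : 'rV[R]_a) :
  differentiable f u -> 'D_v f u = v *m jac f u.
Proof.
move=> df; rewrite derive_dir_rowE // mulmx_sum_row.
by apply: eq_bigr => i _; rewrite rowK.
Qed.

Section OneChart.
Context (U : set 'rV[R]_m) (W : set 'rV[R]_N).
Context (phi : 'rV[R]_m -> 'rV[R]_N) (x : 'rV[R]_N -> 'rV[R]_m).
Hypothesis ch : local_chart M U W phi x.

Lemma chart_open : open U. Proof. by case: ch. Qed.

Lemma chart_image u : U u -> M (phi u) /\ W (phi u).
Proof. by case: ch => _ _ _ _ [E _] Uu; rewrite -[_ /\ _]/((M `&` W) (phi u)) -E; exists u. Qed.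

Lemma chartK u : U u -> x (phi u) = u.
Proof. by case: ch => _ _ _ _ [_]; apply. Qed.

Lemma chart_invK p : M p -> W p -> U (x p) /\ phi (x p) = p.
Proof.
case: ch => _ _ _ _ [E K] Mp Wp.
have : (phi @` U) p by rewrite E.
by move=> [u Uu <-]; rewrite K.
Qed.

Lemma chart_differentiable u : U u -> differentiable phi u.
Proof. by case: ch => _ _ sphi _ _; apply: smooth_differentiable. Qed.

Lemma chart_inv_differentiable p : W p -> differentiable x p.
Proof. by case: ch => _ _ _ sx _; apply: smooth_differentiable. Qed.

Lemma chart_near (S : set 'rV[R]_N) u :
  U u -> (\forall p \near phi u, S p) -> \forall y \near u, S (phi y).
Proof. by move=> Uu; apply: (differentiable_continuous (chart_differentiable Uu)). Qed.

Lemma chart_inv_near (S : set 'rV[R]_m) p :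
  W p -> (\forall y \near x p, S y) -> \forall q \near p, S (x q).
Proof. by move=> Wp; apply: (differentiable_continuous (chart_inv_differentiable Wp)). Qed.

Lemma near_chart_domain p : W p -> \forall q \near p, W q.
Proof. by case: ch => _ oW _ _ _; apply: near_open_set. Qed.

(** A chart has a differentiable left inverse, hence an injective
    differential. *)
Lemma jac_row_free u : U u -> row_free (jac phi u).
Proof.
move=> Uu; rewrite -kermx_eq0; apply/rowV0P => v /sub_kermxP vJ.
have [_ Wu] := chart_image Uu.
have <- : 'D_v (x \o phi) u = v.
  rewrite (eq_on_derive chart_open v Uu (g := id)) ?derive_id //.
  exact: chartK.
rewrite derive_comp; last exact: chart_inv_differentiable.
  by rewrite derive_jac ?vJ ?derive0 //; apply: chart_differentiable.
exact: chart_differentiable.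
Qed.

Lemma smooth_chart : smooth_mx U phi.
Proof. by case: ch => oU _ sphi _ _; apply: smooth_on_mx. Qed.

Lemma smooth_jac : smooth_mx U (jac phi).
Proof.
move=> i j; under eq_fun do rewrite mxE.
by apply: smooth_mx_derive; [exact: chart_open|exact: smooth_chart].
Qed.

End OneChart.

Section TwoCharts.
Context (U : set 'rV[R]_m) (W : set 'rV[R]_N).
Context (phi : 'rV[R]_m -> 'rV[R]_N) (x : 'rV[R]_N -> 'rV[R]_m).
Hypothesis ch : local_chart M U W phi x.
Context (U' : set 'rV[R]_m) (W' : set 'rV[R]_N).
Context (phi' : 'rV[R]_m -> 'rV[R]_N) (x' : 'rV[R]_N -> 'rV[R]_m).
Hypothesis ch' : local_chart M U' W' phi' x'.

Lemma chart_transition u' : U' u' -> W (phi' u') ->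
  \forall y \near u', phi (x (phi' y)) = phi' y.
Proof.
move=> Uu' Wp.
apply: filterS2 (near_open_set (chart_open ch') Uu')
  (chart_near ch' Uu' (near_chart_domain ch Wp)) => y Uy Wy.
by have [] := chart_invK ch (chart_image ch' Uy).1 Wy.
Qed.

(** Near a common point, one parametrization factors through the other by a
    differentiable change of coordinates. *)
Lemma derive_chart_transition u' v : U' u' -> W (phi' u') ->
  'D_v phi' u' = 'D_('D_v (x \o phi') u') phi (x (phi' u')).
Proof.
move=> Uu' Wp; have [Ux _] := chart_invK ch (chart_image ch' Uu').1 Wp.
rewrite -(derive_comp (f := x \o phi')) //.
- by apply/esym/near_eq_derive/chart_transition.
- apply: differentiable_comp; first exact: (chart_differentiable ch').
  exact: (chart_inv_differentiable ch).
- exact: (chart_differentiable ch).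
Qed.

End TwoCharts.

Section ChartCalculus.
Context (U : set 'rV[R]_m) (W : set 'rV[R]_N).
Context (phi : 'rV[R]_m -> 'rV[R]_N) (x : 'rV[R]_N -> 'rV[R]_m).
Hypothesis ch : local_chart M U W phi x.

(** The tangent vectors given by all charts are already given by a single one. *)
Lemma tangent_chartP u X : U u ->
  tangent m M (phi u) X <-> exists v, X = v *m jac phi u.
Proof.
move=> Uu; have [Mp Wp] := chart_image ch Uu.
have dphi := chart_differentiable ch Uu.
split=> [[U' [W' [phi' [x' [Wp' ch' [v ->]]]]]]|[v ->]]; last first.
  exists U, W, phi, x; split=> //; exists v.
  by rewrite (chartK ch Uu) derive_jac.
have [Uu' E] := chart_invK ch' Mp Wp'.
have := derive_chart_transition ch ch' v Uu'.
rewrite E (chartK ch Uu) => /(_ Wp) ->.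
by eexists; apply: derive_jac.
Qed.

(** The retraction may come from another chart phi' with inverse x'. The map
    V \o phi' \o x' is near p the composite of V \o phi with
    x \o phi' \o x', and the latter is a left inverse of phi: by the chain rule
    its differential sends v J back to v. *)
Lemma flatD_chart (V : 'rV[R]_N -> 'rV[R]_N) u v : U u ->
  differentiable (V \o phi) u ->
  flatD m M V (phi u) (v *m jac phi u) = 'D_v (V \o phi) u.
Proof.
move=> Uu dV; have [Mp Wp] := chart_image ch Uu.
have dphi := chart_differentiable ch Uu.
pose S := [set r | exists (U' : set 'rV[R]_m) W' phi' x',
    [/\ W' (phi u), local_chart M U' W' phi' x' & r = phi' \o x']].
have [U' [W' [phi' [x' [Wp' ch' rE]]]]] : S (get S).
  by apply: getPex; exists (phi \o x), U, W, phi, x.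
have {}rE : retraction m M (phi u) = phi' \o x' := rE.
rewrite /flatD rE.
have [Uu' E] := chart_invK ch' Mp Wp'.
have dx' := chart_inv_differentiable ch' Wp'.
have dphi' := chart_differentiable ch' Uu'.
have dr : differentiable (x \o (phi' \o x')) (phi u).
  apply: differentiable_comp; first exact: differentiable_comp.
  by rewrite /= E; apply: (chart_inv_differentiable ch).
have xE : (x \o (phi' \o x')) (phi u) = u by rewrite /= E (chartK ch).
transitivity ('D_(v *m jac phi u) ((V \o phi) \o (x \o (phi' \o x'))) (phi u)).
  apply: near_eq_derive.
  have := chart_transition ch ch' Uu'; rewrite E => /(_ Wp).
  move/(chart_inv_near ch' Wp'); apply: filterS => q /= ->.
  by [].
rewrite (derive_comp _ dr); last by rewrite xE.
rewrite xE; congr ('D_ _ _ _).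
rewrite -derive_jac // -derive_comp //.
transitivity ('D_v id u); last exact: derive_id.
apply: near_eq_derive.
apply: filterS2 (near_open_set (chart_open ch) Uu)
  (chart_near ch Uu (near_chart_domain ch' Wp')) => y Uy Wy.
by rewrite /= (chart_invK ch' (chart_image ch Uy).1 Wy).2 (chartK ch).
Qed.

End ChartCalculus.

End Charts.

(** * Tangential projection in a chart *)

Section RowSpaceProjection.
Context (R : realType) (m N : nat) (J : 'M[R]_(m, N)).

(** Coordinates with respect to the rows of J of the orthogonal projection onto
    their span; J J^T is the Gram matrix. *)
Definition coords : 'M[R]_(N, m) := J^T *m invmx (J *m J^T).
Definition proj : 'M[R]_N := coords *m J.

Lemma trmx_proj : proj^T = proj.
Proof. by rewrite /proj /coords !trmx_mul trmx_inv trmx_mul !trmxK mulmxA. Qed.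

Hypothesis fJ : row_free J.

Lemma mulmx_coords : J *m coords = 1%:M.
Proof. by rewrite mulmxA mulmxV // gram_unitmx. Qed.

Lemma mulmx_proj : J *m proj = J.
Proof. by rewrite mulmxA mulmx_coords mul1mx. Qed.

Lemma proj_idem : proj *m proj = proj.
Proof. by rewrite -{1}/(coords *m J) -mulmxA mulmx_proj. Qed.

Lemma trmx_coords_proj : coords^T *m proj = coords^T.
Proof.
by rewrite trmx_mul trmx_inv trmx_mul !trmxK -mulmxA mulmx_proj.
Qed.

(** If E = B J then B G B^T = 1 for the Gram matrix G = J J^T, so that
    B^T B = G^-1. *)
Lemma orthonormal_proj (E : 'M[R]_(m, N)) :
  E *m E^T = 1%:M -> (E <= J)%MS -> E^T *m E = proj.
Proof.
move=> EE /submxP [B EB].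
have BG : J *m J^T *m (B^T *m B) = 1%:M.
  by rewrite mulmxA; apply: mulmx1C; rewrite -EE EB trmx_mul !mulmxA.
have -> : proj = J^T *m (B^T *m B) *m J.
  congr (_ *m _ *m J).
  by rewrite -[RHS](mulKmx (gram_unitmx fJ)) BG mulmx1.
by rewrite EB trmx_mul !mulmxA.
Qed.

Lemma proj_orthogonal (Y : 'rV[R]_N) (v : 'rV[R]_m) :
  dot (Y - Y *m proj) (v *m J) = 0.
Proof.
rewrite dotBl dot_mulmxl trmx_proj -mulmxA mulmx_proj.
by rewrite subrr.
Qed.

End RowSpaceProjection.

(** For a unit vector p, the orthogonal projection onto the tangent space of the
    sphere at p. *)
Definition sphere_proj (R : realType) (N : nat) (p : 'rV[R]_N) : 'M[R]_N :=
  1%:M - p^T *m p.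

Lemma mulmx_sphere_proj (R : realType) (N : nat) (Y p : 'rV[R]_N) :
  Y *m sphere_proj p = Y - dot Y p *: p.
Proof.
rewrite mulmxBr mulmx1 mulmxA; congr (_ - _).
by rewrite [Y *m p^T]mx11_scalar -dotE mul_scalar_mx.
Qed.

Lemma trmx_sphere_proj (R : realType) (N : nat) (p : 'rV[R]_N) :
  (sphere_proj p)^T = sphere_proj p.
Proof. by rewrite linearB /= trmx1 trmx_mul trmxK. Qed.

Section ChartGeometry.
Context (R : realType) (N m : nat) (M : set 'rV[R]_N).
Context (U : set 'rV[R]_m) (W : set 'rV[R]_N).
Context (phi : 'rV[R]_m -> 'rV[R]_N) (x : 'rV[R]_N -> 'rV[R]_m).
Hypothesis ch : local_chart M U W phi x.

Let oU : open U := chart_open ch.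

Definition tproj (u : 'rV[R]_m) : 'M[R]_N := proj (jac phi u).
Definition tcoords (u : 'rV[R]_m) : 'M[R]_(N, m) := coords (jac phi u).

Lemma smooth_tcoords : smooth_mx U tcoords.
Proof.
have sJ := smooth_jac ch; have sJT := smooth_mxT sJ.
apply: smooth_mxM => //; apply: smooth_mxV => //; last exact: smooth_mxM.
by move=> u Uu; apply/gram_unitmx/(jac_row_free ch).
Qed.

Lemma smooth_tproj : smooth_mx U tproj.
Proof. apply: smooth_mxM => //; [exact: smooth_tcoords|exact: smooth_jac ch]. Qed.

Lemma smooth_sphere_proj : smooth_mx U (fun u => sphere_proj (phi u)).
Proof.
apply: smooth_mxB => //; first exact: smooth_mx_cst.
have sphi := smooth_chart ch.
by apply: smooth_mxM => //; apply: smooth_mxT.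
Qed.

Lemma tangent_tproj u X : U u -> tangent m M (phi u) X <-> X *m tproj u = X.
Proof.
move=> Uu; split=> [/(tangent_chartP ch X Uu) [v ->]|<-].
  by rewrite -mulmxA mulmx_proj //; apply: jac_row_free ch _ Uu.
by apply/(tangent_chartP ch _ Uu); exists (X *m tcoords u); rewrite -mulmxA.
Qed.

Lemma tangent_partE u Y : U u -> tangent_part m M (phi u) Y = Y *m tproj u.
Proof.
move=> Uu; have fJ := jac_row_free ch Uu.
pose S : set 'rV[R]_N := [set Z | tangent m M (phi u) Z /\
   forall X, tangent m M (phi u) X -> dot (Y - Z) X = 0].
have [tZ oZ] : S (get S).
  apply: getPex; exists (Y *m tproj u); split.
    by apply/tangent_tproj => //; rewrite -mulmxA proj_idem.
  by move=> X /(tangent_chartP ch X Uu) [v ->]; apply: proj_orthogonal.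
rewrite -[LHS]/(get S); set Z := get S in tZ oZ *.
apply/eqP; rewrite -subr_eq0; apply/eqP/dot_eq0.
have tD : tangent m M (phi u) (Z - Y *m tproj u).
  apply/tangent_tproj => //; rewrite mulmxBl -mulmxA proj_idem //.
  by congr (_ - _); apply/(tangent_tproj _ Uu).
have /(tangent_chartP ch _ Uu) [v vE] := tD.
have e : Z - Y *m tproj u = (Y - Y *m tproj u) - (Y - Z).
  by rewrite opprB [RHS]addrC subrKA.
rewrite {1}e dotBl oZ // subr0 vE; exact: proj_orthogonal.
Qed.

Lemma normal_partE u Y : U u ->
  normal_part m M (phi u) Y = Y *m (1%:M - tproj u).
Proof. by move=> Uu; rewrite /normal_part tangent_partE // mulmxBr mulmx1. Qed.

(** The sum of the squares e_i^T e_i is the tangential projection whatever the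
    orthonormal basis, which makes traces independent of the basis chosen by
    [tangent_basis], and smooth in the point. *)
Lemma tangent_basisP u : U u ->
  [/\ forall i : 'I_m, tangent m M (phi u) (tangent_basis M (phi u) i),
      forall i : 'I_m,
        dot (tangent_basis M (phi u) i) (tangent_basis M (phi u) i) = 1
    & \sum_(i < m) (tangent_basis M (phi u) i)^T *m tangent_basis M (phi u) i
      = tproj u].
Proof.
move=> Uu; have fJ := jac_row_free ch Uu.
pose S : set ('I_m -> 'rV[R]_N) := [set e |
  (forall i, tangent m M (phi u) (e i)) /\
  (forall i j, dot (e i) (e j) = (i == j)%:R)].
have [te oe] : S (get S).
  have [E [EE EJ]] := orthonormal_rows fJ.
  apply: getPex; exists (fun i => row i E); split=> [i|i j].
    apply/(tangent_chartP ch _ Uu); apply/submxP.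
    by apply: submx_trans EJ; apply: row_sub.
  have := congr1 (fun A : 'M[R]_m => A i j) EE; rewrite !mxE => <-.
  by apply: eq_bigr => k _; rewrite !mxE.
rewrite /tangent_basis -/S; set e := get S in te oe *; split=> //.
  by move=> i; rewrite oe eqxx.
pose E := \matrix_(i < m) e i.
have EE : E *m E^T = 1%:M.
  apply/matrixP => i j; rewrite [RHS]mxE -oe mxE.
  by apply: eq_bigr => k _; rewrite !mxE.
have EJ : (E <= jac phi u)%MS.
  apply/row_subP => i; rewrite rowK.
  by have /(tangent_chartP ch _ Uu) [v ->] := te i; apply: submxMl.
rewrite -[RHS](orthonormal_proj fJ EE EJ).
apply/matrixP => a b; rewrite summxE mxE; apply: eq_bigr => i _.
by rewrite !mxE big_ord1 !mxE.
Qed.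

(** The covariant derivative depends on V through its expression F in the chart
    only; this is the bridge from vector fields along M to matrix calculus. *)
Lemma nablaS_chart (V : 'rV[R]_N -> 'rV[R]_N) (F : 'rV[R]_m -> 'rV[R]_N) u v :
  U u -> smooth_mx U F -> (forall y, U y -> V (phi y) = F y) ->
  nablaS m M V (phi u) (v *m jac phi u) = 'D_v F u *m sphere_proj (phi u).
Proof.
move=> Uu sF VF; rewrite mulmx_sphere_proj /nablaS.
have -> : flatD m M V (phi u) (v *m jac phi u) = 'D_v F u.
  rewrite (flatD_chart ch) //; first exact: (eq_on_derive oU (f := V \o phi) v Uu VF).
  apply: near_eq_differentiable (smooth_mx_differentiable sF Uu).
  by apply: (eq_on_near oU (f := F) (g := V \o phi) Uu) => y Uy; rewrite -VF.
by [].
Qed.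

End ChartGeometry.

(** * Second fundamental form and mean curvature in a chart *)

Section SphericalChart.
Context (R : realType) (N m : nat) (M : set 'rV[R]_N).
Hypothesis unitM : forall p, M p -> dot p p = 1.
Context (U : set 'rV[R]_m) (W : set 'rV[R]_N).
Context (phi : 'rV[R]_m -> 'rV[R]_N) (x : 'rV[R]_N -> 'rV[R]_m).
Hypothesis ch : local_chart M U W phi x.

Let oU : open U := chart_open ch.
Let sphi : smooth_mx U phi := smooth_chart ch.

(** Derivative of the equation |phi|^2 = 1. *)
Lemma jac_chart_orthogonal u : U u -> jac phi u *m (phi u)^T = 0.
Proof.
move=> Uu; apply/matrixP => i j; rewrite !ord1 [RHS]mxE.
have dphi v : derivable phi u v by apply: smooth_mx_derivable sphi Uu.
have : 'D_(delta_mx 0 i) (fun y => dot (phi y) (phi y)) u = 0.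
  rewrite (eq_on_derive oU (g := fun=> (1 : R))) ?derive_cst // => y Uy.
  by apply: unitM; have [] := chart_image ch Uy.
rewrite derive_dot // [X in _ + X]dotC -mulr2n => /eqP.
rewrite mulrn_eq0 /= => /eqP; rewrite dotE !mxE => E.
by rewrite -[RHS]E; apply: eq_bigr => k _; rewrite !mxE.
Qed.

Lemma tproj_chart u : U u -> tproj phi u *m (phi u)^T = 0.
Proof. by move=> Uu; rewrite /tproj /proj -mulmxA jac_chart_orthogonal // mulmx0. Qed.

Lemma chart_tproj u : U u -> phi u *m tproj phi u = 0.
Proof.
move=> Uu; apply: trmx_inj.
by rewrite trmx_mul trmx_proj tproj_chart // trmx0.
Qed.

(** For phi with values in the sphere, the orthogonal projection of the ambient
    space onto the normal space of the submanifold in the sphere. *)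
Definition nproj (u : 'rV[R]_m) : 'M[R]_N :=
  sphere_proj (phi u) *m (1%:M - tproj phi u).

Lemma smooth_nproj : smooth_mx U nproj.
Proof.
have sP := smooth_tproj ch; have sS := smooth_sphere_proj ch.
apply: smooth_mxM => //; apply: smooth_mxB => //; exact: smooth_mx_cst.
Qed.

Lemma sphere_proj_tproj u : U u ->
  sphere_proj (phi u) *m tproj phi u = tproj phi u.
Proof.
move=> Uu.
by rewrite mulmxBl mul1mx -mulmxA chart_tproj // mulmx0 subr0.
Qed.

Lemma nprojE u : U u -> nproj u = sphere_proj (phi u) - tproj phi u.
Proof. by move=> Uu; rewrite /nproj mulmxBr mulmx1 sphere_proj_tproj. Qed.

Lemma trmx_nproj u : U u -> (nproj u)^T = nproj u.
Proof.
by move=> Uu; rewrite nprojE // linearB /= trmx_sphere_proj trmx_proj.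
Qed.

Lemma nproj_tproj u : U u -> nproj u *m tproj phi u = 0.
Proof.
move=> Uu; rewrite nprojE // mulmxBl sphere_proj_tproj //.
by rewrite proj_idem ?subrr //; apply: jac_row_free ch _ Uu.
Qed.

Lemma sphere_proj_self (p : 'rV[R]_N) : dot p p = 1 -> p *m sphere_proj p = 0.
Proof. by move=> pp; rewrite mulmx_sphere_proj pp scale1r subrr. Qed.

Lemma chart_sphere_proj u : U u -> phi u *m sphere_proj (phi u) = 0.
Proof.
by move=> Uu; apply/sphere_proj_self/unitM; have [] := chart_image ch Uu.
Qed.

Lemma chart_nproj u : U u -> phi u *m nproj u = 0.
Proof. by move=> Uu; rewrite /nproj mulmxA chart_sphere_proj // mul0mx. Qed.

Lemma smooth_extend (Y : 'rV[R]_N) : smooth_mx U (fun u => Y *m tproj phi u).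
Proof.
have sP := smooth_tproj ch.
by apply: smooth_mxM => //; apply: smooth_mx_cst.
Qed.

Lemma derive_mulmx_cst (Y : 'rV[R]_N) (F : 'rV[R]_m -> 'M[R]_N) u v :
  derivable F u v -> 'D_v (fun y => Y *m F y) u = Y *m 'D_v F u.
Proof.
move=> dF; have dY := @derivable_cst R _ _ Y u v.
rewrite derive_mulmx // derive_cst mul0mx add0r //.
Qed.

Lemma nablaS_extend u v Y : U u ->
  nablaS m M (extend m M Y) (phi u) (v *m jac phi u) =
  Y *m 'D_v (tproj phi) u *m sphere_proj (phi u).
Proof.
move=> Uu; rewrite (nablaS_chart ch v Uu (smooth_extend Y)).
  rewrite derive_mulmx_cst //.
  by apply: smooth_mx_derivable Uu => //; apply: smooth_tproj ch.
by move=> y Uy; rewrite /extend (tangent_partE ch).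
Qed.

Lemma second_formE u v Y : U u ->
  second_form m M (phi u) (v *m jac phi u) Y =
  Y *m 'D_v (tproj phi) u *m nproj u.
Proof.
by move=> Uu; rewrite /second_form (normal_partE ch) // nablaS_extend // -mulmxA.
Qed.

(** The trace of (X, Y) |-> Y (D_v P) Q, with v the coordinates of X, expanded
    along the partial derivatives of P: the basis vectors e_i enter only through
    sum_i e_i^T e_i = P, so no choice of basis remains in the formula. *)
Definition mean_curvature_chart (u : 'rV[R]_m) : 'rV[R]_N :=
  m%:R^-1 *: ((\sum_(a < m) row a (tcoords phi u)^T *m
                 'D_(delta_mx 0 a) (tproj phi) u) *m nproj u).

Lemma mean_curvatureE u : U u ->
  mean_curvature m M (phi u) = mean_curvature_chart u.
Proof.
move=> Uu; rewrite /mean_curvature /mean_curvature_chart; congr (_ *: _).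
have [te _ sume] := tangent_basisP ch Uu.
set e := tangent_basis M (phi u) in te sume *.
have fJ := jac_row_free ch Uu.
have dP : differentiable (tproj phi) u.
  exact: (smooth_mx_differentiable (smooth_tproj ch) Uu).
rewrite /trace -/e mulmx_suml.
transitivity (\sum_(i < m) \sum_(a < m) ((e i *m tcoords phi u) 0 a *: e i *m
    'D_(delta_mx 0 a) (tproj phi) u) *m nproj u).
  apply: eq_bigr => i _.
  have eE : e i = (e i *m tcoords phi u) *m jac phi u.
    by rewrite -mulmxA; apply/esym/(tangent_tproj ch _ Uu).
  rewrite {1}eE second_formE // derive_dir_rowE // mulmx_sumr mulmx_suml.
  by apply: eq_bigr => a _; rewrite -scalemxAr -!scalemxAl.
rewrite exchange_big; apply: eq_bigr => a _ /=.
rewrite -mulmx_suml -mulmx_suml; congr (_ *m _ *m _).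
have <- : (tcoords phi u)^T *m tproj phi u = (tcoords phi u)^T.
  exact: trmx_coords_proj.
rewrite -sume mulmx_sumr linear_sum /=; apply: eq_bigr => i _.
by rewrite mulmxA -trmx_mul; apply/rowP => j; rewrite !mxE big_ord1 !mxE.
Qed.

Lemma smooth_mean_curvature : smooth_mx U mean_curvature_chart.
Proof.
have sP := smooth_tproj ch; have sc := smooth_tcoords ch.
apply: smooth_mx_scale => //; first exact: smooth_cst.
apply: smooth_mxM => //; last exact: smooth_nproj.
apply: smooth_mx_sum => // a _; apply: smooth_mxM => //.
  by move=> i j; under eq_fun do rewrite mxE mxE; exact: sc.
exact: smooth_mx_derive.
Qed.

Lemma mean_curvature_chart_tproj u : U u ->
  mean_curvature_chart u *m tproj phi u = 0.
Proof.
by move=> Uu; rewrite -scalemxAl -mulmxA nproj_tproj // mulmx0 scaler0.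
Qed.

Lemma mean_curvature_chart_orthogonal u : U u ->
  dot (mean_curvature_chart u) (phi u) = 0.
Proof.
move=> Uu; rewrite /mean_curvature_chart dotZl dot_mulmxl trmx_nproj //.
by rewrite chart_nproj // dotC dot0l mulr0.
Qed.

End SphericalChart.

(** * The Hessian at a maximum of the norm *)

Section SectionsInChart.
Context (R : realType) (N m : nat) (M : set 'rV[R]_N).
Hypothesis unitM : forall p, M p -> dot p p = 1.
Context (U : set 'rV[R]_m) (W : set 'rV[R]_N).
Context (phi : 'rV[R]_m -> 'rV[R]_N) (x : 'rV[R]_N -> 'rV[R]_m).
Hypothesis ch : local_chart M U W phi x.

Let oU : open U := chart_open ch.

Lemma sphere_proj_idem (p : 'rV[R]_N) :
  dot p p = 1 -> sphere_proj p *m sphere_proj p = sphere_proj p.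
Proof.
move=> pp; rewrite {1}/sphere_proj mulmxBl mul1mx -mulmxA.
by rewrite sphere_proj_self // mulmx0 subr0.
Qed.

Context (V : 'rV[R]_N -> 'rV[R]_N) (F : 'rV[R]_m -> 'rV[R]_N).
Hypothesis sF : smooth_mx U F.
Hypothesis VF : forall y, U y -> V (phi y) = F y.
Hypothesis Fphi : forall y, U y -> dot (F y) (phi y) = 0.

Let dF u v : U u -> derivable F u v.
Proof. by move=> Uu; apply: smooth_mx_derivable sF Uu. Qed.

Lemma section_sphere_proj u : U u -> F u *m sphere_proj (phi u) = F u.
Proof. by move=> Uu; rewrite mulmx_sphere_proj Fphi // scale0r subr0. Qed.

Lemma smooth_jac_section : smooth_mx U (jac F).
Proof.
by move=> i j; under eq_fun do rewrite mxE; apply: smooth_mx_derive.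
Qed.

Lemma smooth_nablaS_extend (Y : 'rV[R]_N) :
  smooth_mx U (fun y => Y *m tcoords phi y *m jac F y *m sphere_proj (phi y)).
Proof.
have sc := smooth_tcoords ch; have sS := smooth_sphere_proj ch.
apply: smooth_mxM => //; apply: smooth_mxM => //; last exact: smooth_jac_section.
by apply: smooth_mxM => //; apply: smooth_mx_cst.
Qed.

Lemma nablaS_extendE (Y : 'rV[R]_N) y : U y ->
  nablaS m M V (phi y) (extend m M Y (phi y)) =
  Y *m tcoords phi y *m jac F y *m sphere_proj (phi y).
Proof.
move=> Uy; rewrite /extend (tangent_partE ch) // /tproj /proj mulmxA.
rewrite (nablaS_chart ch _ Uy sF VF) -derive_jac //.
exact: (smooth_mx_differentiable sF Uy).
Qed.

Lemma hessianE u v X Y : U u -> X = v *m jac phi u -> exists z,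
  hessian m M V (phi u) X Y =
  'D_v (fun y => Y *m tcoords phi y *m jac F y *m sphere_proj (phi y)) u
    *m sphere_proj (phi u) - 'D_z F u *m sphere_proj (phi u).
Proof.
move=> Uu ->; rewrite /hessian (nablaS_chart ch v Uu (smooth_nablaS_extend Y)); last first.
  by move=> y Uy; rewrite nablaS_extendE.
rewrite /nablaM (tangent_partE ch) // /tproj /proj mulmxA.
by eexists; rewrite (nablaS_chart ch _ Uu sF VF).
Qed.

Lemma derive_sqr_section u v : U u ->
  'D_v (fun y => dot (F y) (F y)) u = ('D_v F u *m (F u)^T) 0 0 *+ 2.
Proof.
move=> Uu; have dFu := @dF u v Uu.
by rewrite derive_dot // [X in _ + X]dotC -mulr2n dotE.
Qed.

(** Write s for the covariant derivative of V along the field extending Y, and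
    f = |F|^2. Near u the scalar product <s, F> is half the derivative of f
    along the coordinates of that field; at the maximum the gradient of f
    vanishes, so differentiating once more along Y gives
    <D s, F> + <s, D F> = f'' / 2 <= 0. The first term is the scalar product of
    the Hessian with F, as the correction term of the Hessian is a first
    derivative of f; the second is the square of the covariant derivative. *)
Lemma hessian_max u Y : U u -> tangent m M (phi u) Y ->
  (\forall y \near u, dot (F y) (F y) <= dot (F u) (F u)) ->
  dot (hessian m M V (phi u) Y Y) (F u) +
  dot (nablaS m M V (phi u) Y) (nablaS m M V (phi u) Y) <= 0.
Proof.
move=> Uu tY fmax; have [Mu _] := chart_image ch Uu.
have SS := sphere_proj_idem (unitM Mu).
pose w0 := Y *m tcoords phi u.
have YE : Y = w0 *m jac phi u.
  by rewrite -mulmxA; apply/esym/(tangent_tproj ch _ Uu).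
(* half the gradient of |F|^2 *)
pose grad y := jac F y *m (F y)^T.
have sgrad : smooth_mx U grad.
  by apply: smooth_mxM => //; [exact: smooth_jac_section|exact: smooth_mxT].
have gradE v y : U y -> 'D_v (fun y => dot (F y) (F y)) y = ((v *+ 2) *m grad y) 0 0.
  move=> Uy; rewrite derive_sqr_section // derive_jac; last first.
    exact: (smooth_mx_differentiable sF Uy).
  by rewrite -mulmxA !mulr2n mulmxDl [RHS]mxE.
have swgrad (v : 'rV[R]_m) : smooth_mx U (fun y => v *m grad y).
  by apply: smooth_mxM => //; apply: smooth_mx_cst.
have sf : smooth_on U (fun y => dot (F y) (F y)).
  under eq_fun do rewrite dotE.
  by apply: (smooth_mxM oU sF (smooth_mxT sF)).
have maxv v : 'D_v (fun y => dot (F y) (F y)) u = 0 /\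
    'D_v (fun y => ((v *+ 2) *m grad y) 0 0) u <= 0.
  have [|||D1 D2] := @local_max_derive R _ (fun y => dot (F y) (F y)) u v.
  - apply: filterS (near_open_set oU Uu) => y Uy.
    by apply/diff_derivable/(smooth_differentiable sf).
  - by apply/diff_derivable/(smooth_differentiable (smooth_derive v sf)).
  - exact: fmax.
  split=> //; rewrite -(eq_on_derive oU (f := fun y => 'D_v (fun y => dot (F y) (F y)) y)) //.
  by move=> y Uy; rewrite gradE.
have grad0 : grad u = 0.
  apply/matrixP => i j; rewrite ord1 [RHS]mxE.
  have [/eqP + _] := maxv (delta_mx 0 i); rewrite gradE // mulr2n mulmxDl mxE -mulr2n.
  rewrite mulrn_eq0 /= => /eqP.
  by rewrite -rowE mxE.
pose s y := Y *m tcoords phi y *m jac F y *m sphere_proj (phi y).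
have ss : smooth_mx U s := smooth_nablaS_extend Y.
have su : nablaS m M V (phi u) Y = s u.
  have eY : extend m M Y (phi u) = Y.
    by rewrite /extend (tangent_partE ch Y Uu); apply/(tangent_tproj ch Y Uu).
  by have := nablaS_extendE Y Uu; rewrite eY.
have suE : s u = 'D_w0 F u *m sphere_proj (phi u).
  by rewrite derive_jac //; apply: (smooth_mx_differentiable sF Uu).
(* differentiate <s, F> = w grad along w0, where w y = Y *m tcoords phi y and
   grad u = 0 *)
have sw : smooth_mx U (fun y => Y *m tcoords phi y).
  by apply: smooth_mxM => //; [exact: smooth_mx_cst|exact: smooth_tcoords ch].
have key : dot ('D_w0 s u) (F u) + dot (s u) ('D_w0 F u) =
    (w0 *m 'D_w0 grad u) 0 0.
  have ds := smooth_mx_derivable (v := w0) ss Uu.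
  have dFu := @dF u w0 Uu.
  have dw := smooth_mx_derivable (v := w0) sw Uu.
  have dg := smooth_mx_derivable (v := w0) sgrad Uu.
  have dwg : derivable (fun y => Y *m tcoords phi y *m grad y) u w0.
    exact: (smooth_mx_derivable (v := w0) (smooth_mxM oU sw sgrad) Uu).
  rewrite -derive_dot //.
  rewrite (eq_on_derive oU (g := fun y => (Y *m tcoords phi y *m grad y) 0 0)) //.
    rewrite -derive_mx_entry // derive_mulmx // grad0 mulmx0 add0r //.
  move=> y Uy; rewrite /s dotE /grad -!mulmxA; congr ((_ *m (_ *m (_ *m _))) 0 0).
  congr (_ *m _); apply: trmx_inj; rewrite trmx_mul trmxK trmx_sphere_proj.
  exact: section_sphere_proj.
have key2 : (w0 *m 'D_w0 grad u) 0 0 <= 0.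
  have [_] := maxv w0.
  have dg := smooth_mx_derivable (v := w0) sgrad Uu.
  have dwg := smooth_mx_derivable (v := w0) (swgrad (w0 *+ 2)) Uu.
  have dw2 := @derivable_cst R _ _ (w0 *+ 2) u w0.
  rewrite -derive_mx_entry // derive_mulmx // derive_cst mul0mx add0r.
  rewrite mulr2n mulmxDl; move: (w0 *m _) => t.
  by rewrite mxE -mulr2n pmulrn_lle0.
have [z hE] : exists z, hessian m M V (phi u) Y Y =
    'D_w0 s u *m sphere_proj (phi u) - 'D_z F u *m sphere_proj (phi u).
  exact: (hessianE Y Uu YE).
have FS : F u *m (sphere_proj (phi u))^T = F u.
  by rewrite trmx_sphere_proj section_sphere_proj.
have zF : dot ('D_z F u) (F u) = 0.
  rewrite dotE derive_jac; last exact: (smooth_mx_differentiable sF Uu).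
  by rewrite -mulmxA -/(grad u) grad0 mulmx0 mxE.
have ssE : dot (s u) (s u) = dot (s u) ('D_w0 F u).
  by rewrite {2}suE dotC dot_mulmxl trmx_sphere_proj suE -mulmxA SS dotC.
have hF : dot (hessian m M V (phi u) Y Y) (F u) = dot ('D_w0 s u) (F u).
  by rewrite hE dotBl (dot_mulmxl _ ('D_w0 s u)) (dot_mulmxl _ ('D_z F u)) FS zF subr0.
by rewrite hF su ssE key.
Qed.

End SectionsInChart.

(** * Weingarten operator of a normal field *)

Section NormalSections.
Context (R : realType) (N m : nat) (M : set 'rV[R]_N).
Hypothesis unitM : forall p, M p -> dot p p = 1.
Context (U : set 'rV[R]_m) (W : set 'rV[R]_N).
Context (phi : 'rV[R]_m -> 'rV[R]_N) (x : 'rV[R]_N -> 'rV[R]_m).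
Hypothesis ch : local_chart M U W phi x.

Let oU : open U := chart_open ch.

Lemma tangent_unique u Z Z' : U u -> tangent m M (phi u) Z ->
  tangent m M (phi u) Z' ->
  (forall Y, tangent m M (phi u) Y -> dot Z Y = dot Z' Y) -> Z = Z'.
Proof.
move=> Uu tZ tZ' ZZ'; apply/eqP; rewrite -subr_eq0; apply/eqP/dot_eq0.
rewrite dotBl ZZ' ?subrr //; apply/(tangent_tproj ch _ Uu); rewrite mulmxBl.
by congr (_ - _); apply/(tangent_tproj ch _ Uu).
Qed.

Context (V : 'rV[R]_N -> 'rV[R]_N) (F : 'rV[R]_m -> 'rV[R]_N).
Hypothesis sF : smooth_mx U F.
Hypothesis VF : forall y, U y -> V (phi y) = F y.
Hypothesis Fphi : forall y, U y -> dot (F y) (phi y) = 0.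
Hypothesis Ftan : forall y, U y -> F y *m tproj phi y = 0.

Lemma section_nproj u : U u -> F u *m nproj phi u = F u.
Proof.
move=> Uu; rewrite (nprojE unitM ch) // mulmxBr Ftan // subr0.
exact: (section_sphere_proj Fphi).
Qed.

(** Derivative of <F, Y P> = 0, which says that F is normal. *)
Lemma dot_nablaS_normal u X Y : U u -> tangent m M (phi u) X ->
  tangent m M (phi u) Y ->
  dot (nablaS m M V (phi u) X) Y =
  - dot (second_form m M (phi u) X Y) (V (phi u)).
Proof.
move=> Uu /(tangent_chartP ch _ Uu) [v ->] tY.
have /(tangent_tproj ch _ Uu) YP := tY.
rewrite (nablaS_chart ch _ Uu sF VF) (second_formE ch) // VF //.
rewrite !dot_mulmxl trmx_sphere_proj (trmx_nproj unitM ch) // section_nproj //.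
have YS : Y *m sphere_proj (phi u) = Y.
  rewrite mulmx_sphere_proj -YP dot_mulmxl trmx_proj.
  by rewrite (chart_tproj unitM ch) // dotC dot0l scale0r subr0.
rewrite YS.
have sP := smooth_tproj ch.
have dF := smooth_mx_derivable (v := v) sF Uu.
have dP := smooth_mx_derivable (v := v) sP Uu.
have sYP := smooth_extend ch Y.
have dYP := smooth_mx_derivable (v := v) sYP Uu.
have : 'D_v (fun y => dot (F y) (Y *m tproj phi y)) u = 0.
  rewrite (eq_on_derive oU (g := fun=> (0 : R))) ?derive_cst // => y Uy.
  by rewrite dotC dot_mulmxl trmx_proj Ftan // dotC dot0l.
rewrite derive_dot // derive_mulmx_cst // YP => /eqP.
by rewrite addr_eq0 => /eqP ->; rewrite -dot_mulmxl [in RHS]dotC.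
Qed.

Lemma weingarten_normal u X : U u -> tangent m M (phi u) X ->
  weingarten m M (phi u) (V (phi u)) X =
  - tangent_part m M (phi u) (nablaS m M V (phi u) X).
Proof.
move=> Uu tX; set Z := nablaS _ _ _ _ _.
have tT : tangent m M (phi u) (- tangent_part m M (phi u) Z).
  apply/(tangent_tproj ch _ Uu); rewrite (tangent_partE ch) // mulNmx.
  by rewrite -mulmxA proj_idem //; apply: jac_row_free ch _ Uu.
have dT Y : tangent m M (phi u) Y ->
    dot (- tangent_part m M (phi u) Z) Y =
    dot (second_form m M (phi u) X Y) (V (phi u)).
  move=> tY; have /(tangent_tproj ch _ Uu) YP := tY.
  rewrite (tangent_partE ch) // dotNl dot_mulmxl trmx_proj.
  by rewrite -/(tproj phi u) YP dot_nablaS_normal // opprK.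
pose S : set 'rV[R]_N := [set Z | tangent m M (phi u) Z /\
  forall Y, tangent m M (phi u) Y ->
    dot Z Y = dot (second_form m M (phi u) X Y) (V (phi u))].
have [tg dg] : S (get S).
  by apply: getPex; exists (- tangent_part m M (phi u) Z).
rewrite -[LHS]/(get S); apply: (tangent_unique Uu) => // Y tY.
by rewrite dg // dT.
Qed.

Lemma sqr_nablaS_normal u X : U u -> tangent m M (phi u) X ->
  dot (nablaS m M V (phi u) X) (nablaS m M V (phi u) X) =
  dot (weingarten m M (phi u) (V (phi u)) X)
      (weingarten m M (phi u) (V (phi u)) X) +
  dot (nablaN m M V (phi u) X) (nablaN m M V (phi u) X).
Proof.
move=> Uu tX; rewrite weingarten_normal // /nablaN /normal_part.
move: (nablaS m M V (phi u) X) => Z.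
rewrite (tangent_partE ch) // dotNl dotNr opprK.
have : dot (Z - Z *m tproj phi u) (Z *m tproj phi u) = 0.
  have -> : dot (Z - Z *m tproj phi u) (Z *m tproj phi u) =
      dot (Z - Z *m tproj phi u) (Z *m tcoords phi u *m jac phi u).
    by rewrite -mulmxA.
  exact: (proj_orthogonal (jac_row_free ch Uu)).
move: (Z *m _) => T ZT.
rewrite dotBl in ZT; have {}ZT := subr0_eq ZT.
by rewrite dotBl !dotBr (dotC T Z) ZT subrr subr0 addrC subrK.
Qed.

(** In a chart the normal derivative at a point is multiplication of the tangent
    vector by a fixed matrix, and X = sum_i <X, e_i> e_i. *)
Lemma nablaN_normal_eq0 u : U u ->
  (forall i : 'I_m, nablaN m M V (phi u) (tangent_basis M (phi u) i) = 0) ->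
  forall X, tangent m M (phi u) X -> nablaN m M V (phi u) X = 0.
Proof.
move=> Uu N0 X tX; have [te _ sume] := tangent_basisP ch Uu.
pose B := tcoords phi u *m jac F u *m sphere_proj (phi u) *m (1%:M - tproj phi u).
have NE Y : tangent m M (phi u) Y -> nablaN m M V (phi u) Y = Y *m B.
  move=> /(tangent_tproj ch _ Uu) YP; rewrite /nablaN (normal_partE ch) //.
  rewrite -{1}YP /tproj /proj mulmxA (nablaS_chart ch _ Uu sF VF).
  rewrite derive_jac ?mulmxA //; exact: (smooth_mx_differentiable sF Uu).
rewrite NE //; have /(tangent_tproj ch _ Uu) <- := tX.
rewrite -sume mulmx_sumr mulmx_suml big1 // => i _.
by rewrite -!mulmxA -NE // N0 !mulmx0.
Qed.

End NormalSections.

(** * Normal fields on the submanifold *)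

Section PointwiseStatements.
Context (R : realType) (N m : nat) (M : set 'rV[R]_N).
Hypothesis unitM : forall p, M p -> dot p p = 1.
Hypothesis smM : submanifold m M.

(** The vector fields along M that are smooth and normal to M in the sphere,
    described in every chart. The mean curvature is the field of interest; the
    statements below only rely on these properties of it. *)
Definition smooth_normal_field (V : 'rV[R]_N -> 'rV[R]_N) : Prop :=
  forall U W phi x, local_chart (m := m) M U W phi x ->
  exists F : 'rV[R]_m -> 'rV[R]_N,
    [/\ smooth_mx U F, forall y, U y -> V (phi y) = F y,
        forall y, U y -> dot (F y) (phi y) = 0
      & forall y, U y -> F y *m tproj phi y = 0].

Lemma mean_curvature_smooth_normal : smooth_normal_field (mean_curvature m M).
Proof.
move=> U W phi x ch; exists (mean_curvature_chart phi); split.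
- exact: smooth_mean_curvature ch.
- by move=> y Uy; apply: (mean_curvatureE ch).
- by move=> y Uy; apply: (mean_curvature_chart_orthogonal unitM ch).
- by move=> y Uy; apply: (mean_curvature_chart_tproj unitM ch).
Qed.

Lemma chart_at p : M p -> exists U W phi x u,
  [/\ local_chart (m := m) M U W phi x, U u & phi u = p].
Proof.
move=> Mp; have [U [W [phi [x [Wp ch]]]]] := smM Mp.
by have [Ux E] := chart_invK ch Mp Wp; exists U, W, phi, x, (x p).
Qed.

Lemma tangent_basis_tangent p (i : 'I_m) :
  M p -> tangent m M p (tangent_basis M p i).
Proof.
by move=> /chart_at [U [W [phi [x [u [ch Uu <-]]]]]]; have [] := tangent_basisP ch Uu.
Qed.

Lemma tangent_basis_unit p (i : 'I_m) :
  M p -> dot (tangent_basis M p i) (tangent_basis M p i) = 1.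
Proof.
by move=> /chart_at [U [W [phi [x [u [ch Uu <-]]]]]]; have [] := tangent_basisP ch Uu.
Qed.

Section NormalField.
Context (V : 'rV[R]_N -> 'rV[R]_N).
Hypothesis nV : smooth_normal_field V.

Lemma continuous_sqr_normal_field : {within M, continuous (fun p => dot (V p) (V p))}.
Proof.
apply/subspace_continuousP => p Mp.
have [U [W [phi [x [Wp ch]]]]] := smM Mp.
have [Up phip] := chart_invK ch Mp Wp.
have [F [sF VF _ _]] := nV ch.
have cF : {for p, continuous (fun q => dot (F (x q)) (F (x q)))}.
  apply: differentiable_continuous.
  apply: (differentiable_comp (g := fun y => dot (F y) (F y))).
    exact: (chart_inv_differentiable ch Wp).
  apply: (smooth_differentiable _ Up).
  under eq_fun do rewrite dotE.
  exact: (smooth_mxM (chart_open ch) sF (smooth_mxT sF)).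
have {}cF : (fun q => dot (F (x q)) (F (x q))) @ within M (nbhs p) -->
    dot (F (x p)) (F (x p)) by apply: cvg_within_filter.
have E : dot (F (x p)) (F (x p)) = dot (V p) (V p) by rewrite -VF // phip.
rewrite E in cF; apply: cvg_trans cF; apply: near_eq_cvg; rewrite near_withinE.
apply: filterS (near_chart_domain ch Wp) => q Wq Mq.
have [Uq phiq] := chart_invK ch Mq Wq.
by rewrite -VF // phiq.
Qed.

Lemma laplacian_at_max p : M p ->
  (forall q, M q -> dot (V q) (V q) <= dot (V p) (V p)) ->
  \sum_(i < m) dot (nablaS m M V p (tangent_basis M p i))
                   (nablaS m M V p (tangent_basis M p i))
  <= dot (rough_laplacian m M V p) (V p).
Proof.
move=> Mp pmax; rewrite /rough_laplacian dotNl dot_suml -sumrN.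
apply: ler_sum => i _; rewrite -subr_le0 opprK addrC.
have te := tangent_basis_tangent i Mp.
move: (tangent_basis M p i) te => e te.
have [U [W [phi [x [u [ch Uu pE]]]]]] := chart_at Mp; subst p.
have [F [sF VF Fphi _]] := nV ch.
have := hessian_max unitM ch sF VF Fphi Uu te; rewrite (VF _ Uu); apply.
apply: filterS (near_open_set (chart_open ch) Uu) => y Uy.
rewrite -(VF _ Uu) -(VF _ Uy); apply: pmax.
by have [] := chart_image ch Uy.
Qed.

Lemma sqr_nablaS_normal_field p X : M p -> tangent m M p X ->
  dot (nablaS m M V p X) (nablaS m M V p X) =
  dot (weingarten m M p (V p) X) (weingarten m M p (V p) X) +
  dot (nablaN m M V p X) (nablaN m M V p X).
Proof.
move=> /chart_at [U [W [phi [x [u [ch Uu <-]]]]]] tX.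
have [F [sF VF Fphi Ftan]] := nV ch.
exact: (sqr_nablaS_normal unitM ch sF VF Fphi Ftan Uu tX).
Qed.

Lemma nablaS_normal_field p X : M p -> tangent m M p X ->
  nablaS m M V p X = - weingarten m M p (V p) X + nablaN m M V p X.
Proof.
move=> /chart_at [U [W [phi [x [u [ch Uu <-]]]]]] tX.
have [F [sF VF Fphi Ftan]] := nV ch.
rewrite (weingarten_normal unitM ch sF VF Fphi Ftan Uu tX) opprK.
by rewrite /nablaN /normal_part addrC subrK.
Qed.

Lemma nablaN_normal_field_eq0 p : M p ->
  (forall i : 'I_m, nablaN m M V p (tangent_basis M p i) = 0) ->
  forall X, tangent m M p X -> nablaN m M V p X = 0.
Proof.
move=> /chart_at [U [W [phi [x [u [ch Uu <-]]]]]] N0.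
have [F [sF VF Fphi Ftan]] := nV ch.
exact: (nablaN_normal_eq0 ch sF VF Uu N0).
Qed.

End NormalField.

Lemma nablaS_eq0 (V : 'rV[R]_N -> 'rV[R]_N) : (forall q, M q -> V q = 0) ->
  forall p X, M p -> tangent m M p X -> nablaS m M V p X = 0.
Proof.
move=> V0 p X /chart_at [U [W [phi [x [u [ch Uu <-]]]]]] tX.
have /(tangent_chartP ch _ Uu) [v ->] := tX.
rewrite (nablaS_chart ch v Uu (F := fun=> 0)).
- by rewrite derive_cst mul0mx.
- exact: (smooth_mx_cst (chart_open ch)).
- by move=> y Uy; apply: V0; have [] := chart_image ch Uy.
Qed.

(** The Hessian of V at (X, Y) is then - a times the covariant derivative of the
    field extending Y minus its tangential part, that is, - a times the second
    fundamental form. *)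
Lemma rough_laplacian_scalar (V : 'rV[R]_N -> 'rV[R]_N) (a : R) :
  (forall q X, M q -> tangent m M q X -> nablaS m M V q X = - (a *: X)) ->
  forall p, M p -> rough_laplacian m M V p = a *: trace m M p (second_form m M p).
Proof.
move=> VS p Mp; rewrite /rough_laplacian /trace scaler_sumr -sumrN.
apply: eq_bigr => i _; have te := tangent_basis_tangent i Mp.
move: (tangent_basis M p i) te => e te.
have [U [W [phi [x [u [ch Uu pE]]]]]] := chart_at Mp; subst p.
have sP := smooth_tproj ch.
have sE := smooth_extend ch e.
have oU := chart_open ch.
rewrite /hessian /second_form /normal_part -/(nablaM m M (extend m M e) (phi u) e).
have tM Z : tangent m M (phi u) (tangent_part m M (phi u) Z).
  rewrite (tangent_partE ch) //; apply/(tangent_tproj ch _ Uu).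
  by rewrite -mulmxA proj_idem //; apply: jac_row_free ch _ Uu.
rewrite VS //; last exact: tM.
have -> : nablaS m M (fun q => nablaS m M V q (extend m M e q)) (phi u) e =
    - (a *: nablaS m M (extend m M e) (phi u) e).
  have [v eE] := (tangent_chartP ch e Uu).1 te.
  have sG : smooth_mx U (fun y => - a *: (e *m tproj phi y)).
    by apply: smooth_mx_scale => //; apply: smooth_cst.
  have WG y : U y -> nablaS m M V (phi y) (extend m M e (phi y)) =
      - a *: (e *m tproj phi y).
    move=> Uy; have [My _] := chart_image ch Uy.
    rewrite /extend (tangent_partE ch e Uy) scaleNr; apply: VS => //.
    apply/(tangent_tproj ch _ Uy).
    by rewrite -mulmxA proj_idem //; apply: jac_row_free ch _ Uy.
  have EG y : U y -> extend m M e (phi y) = e *m tproj phi y.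
    exact: (tangent_partE ch e).
  have := nablaS_chart (V := fun q => nablaS m M V q (extend m M e q))
    ch v Uu sG WG.
  have := nablaS_chart (V := extend m M e) ch v Uu sE EG.
  rewrite -eE => -> ->; rewrite deriveZ; last exact: (smooth_mx_derivable sE Uu).
  by rewrite scaleNr mulNmx -scalemxAl.
by rewrite -opprD opprK [RHS]scalerBr.
Qed.

End PointwiseStatements.

(** * Biharmonic normal fields *)

Section BiharmonicNormalFields.
Context (R : realType) (N m : nat) (M : set 'rV[R]_N).
Hypothesis unitM : forall p, M p -> dot p p = 1.
Hypothesis smM : submanifold m M.
Context (V : 'rV[R]_N -> 'rV[R]_N) (k : R).
Hypothesis nV : smooth_normal_field m M V.

Definition biharmonic_field : Prop := forall p, M p ->
  rough_laplacian m M V p - m%:R *: V p + k *: V p = 0.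

Lemma exists_max_normal_field : M !=set0 -> compact M -> exists2 p, M p &
  forall q, M q -> dot (V q) (V q) <= dot (V p) (V p).
Proof.
move=> M0 cM.
have [p /set_mem Mp pmax] :=
  compact_EVT_max M0 cM (continuous_sqr_normal_field smM nV).
by exists p => // q Mq; apply: pmax; apply/mem_set.
Qed.

Lemma biharmonic_laplacian p : biharmonic_field -> M p ->
  dot (rough_laplacian m M V p) (V p) = (m%:R - k) * dot (V p) (V p).
Proof.
move=> bV Mp; have := bV p Mp.
move: (rough_laplacian m M V p) => L LE.
have -> : L = (m%:R - k) *: V p.
  apply/eqP; rewrite -subr_eq0 scalerBl opprB addrA -LE; apply/eqP.
  by rewrite addrAC.
by rewrite dotZl.
Qed.

Lemma biharmonic_field_eq0 : M !=set0 -> compact M -> m%:R < k ->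
  biharmonic_field -> forall p, M p -> V p = 0.
Proof.
move=> M0 cM mk bV q Mq.
have [p Mp pmax] := exists_max_normal_field M0 cM.
have L := laplacian_at_max unitM smM nV Mp pmax.
rewrite biharmonic_laplacian // in L.
have S0 : 0 <= \sum_(i < m) dot (nablaS m M V p (tangent_basis M p i))
                   (nablaS m M V p (tangent_basis M p i)).
  by apply: sumr_ge0 => i _; apply: dot_ge0.
have := le_trans S0 L; rewrite nmulr_rge0 ?subr_lt0 // => fp0.
apply: dot_eq0; apply/eqP; rewrite eq_le dot_ge0 andbT.
exact: le_trans (pmax q Mq) fp0.
Qed.

Hypothesis umbV : forall p X, M p -> tangent m M p X ->
  weingarten m M p (V p) X = dot (V p) (V p) *: X.

Lemma umbilical_at_max p : biharmonic_field -> M p ->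
  (forall q, M q -> dot (V q) (V q) <= dot (V p) (V p)) ->
  m%:R * dot (V p) (V p) ^+ 2 +
    \sum_(i < m) dot (nablaN m M V p (tangent_basis M p i))
                     (nablaN m M V p (tangent_basis M p i))
  <= (m%:R - k) * dot (V p) (V p).
Proof.
move=> bV Mp pmax; have := laplacian_at_max unitM smM nV Mp pmax.
rewrite biharmonic_laplacian //; apply: le_trans.
have -> : m%:R * dot (V p) (V p) ^+ 2 = \sum_(i < m) dot (V p) (V p) ^+ 2.
  by rewrite sumr_const card_ord mulr_natl.
rewrite -big_split; apply: ler_sum => i _ /=.
have te := tangent_basis_tangent smM i Mp.
rewrite (sqr_nablaS_normal_field unitM smM nV Mp te) umbV //.
by rewrite dotZl dotZr (tangent_basis_unit smM i Mp) mulr1 -expr2.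
Qed.

(** With a the maximum of |V|^2, the inequality of [umbilical_at_max] gives
    m a <= m - k, while m - k <= m |V_q|^2 <= m a at every point q: all these
    are equalities, every q is a maximum, and the sum of the squares of the
    normal derivatives in that inequality is zero. *)
Lemma biharmonic_umbilical_parallel : M !=set0 -> compact M -> k < m%:R ->
  (forall p, M p -> m%:R - k <= m%:R * dot (V p) (V p)) ->
  biharmonic_field -> (exists2 p, M p & V p != 0) ->
  exists a, [/\ 0 < a, forall p, M p -> dot (V p) (V p) = a,
    k = m%:R * (1 - a)
    & forall p X, M p -> tangent m M p X -> nablaN m M V p X = 0].
Proof.
move=> M0 cM km kf bV [q0 Mq0 Vq0].
have [p Mp pmax] := exists_max_normal_field M0 cM.
pose S q := \sum_(i < m) dot (nablaN m M V q (tangent_basis M q i))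
                     (nablaN m M V q (tangent_basis M q i)).
have S0 q : 0 <= S q by apply: sumr_ge0 => i _; apply: dot_ge0.
have maxS q : M q -> (forall r, M r -> dot (V r) (V r) <= dot (V q) (V q)) ->
    m%:R * dot (V q) (V q) ^+ 2 + S q <= (m%:R - k) * dot (V q) (V q).
  exact: umbilical_at_max.
have a0 : 0 < dot (V p) (V p).
  apply: lt_le_trans (pmax _ Mq0); rewrite lt_neqAle dot_ge0 andbT eq_sym.
  by apply: contra Vq0 => /eqP /dot_eq0 ->.
have mk0 : 0 < m%:R - k by rewrite subr_gt0.
have m0 : 0 < m%:R :> R.
  have := lt_le_trans mk0 (kf p Mp); rewrite pmulr_lgt0 //.
have ka : m%:R - k = m%:R * dot (V p) (V p).
  apply/eqP; rewrite eq_le kf //= -(ler_pM2r a0) -mulrA -expr2.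
  by apply: le_trans (maxS p Mp pmax); rewrite lerDl.
exists (dot (V p) (V p)).
have cst q : M q -> dot (V q) (V q) = dot (V p) (V p).
  move=> Mq; apply/eqP; rewrite eq_le pmax //= -(ler_pM2l m0) -ka.
  exact: kf.
split=> //.
  by rewrite mulrBr mulr1 -ka opprB addrC subrK.
move=> q X Mq; apply: (nablaN_normal_field_eq0 smM nV Mq) => i.
have qmax r : M r -> dot (V r) (V r) <= dot (V q) (V q).
  by move=> Mr; rewrite !cst.
have := maxS q Mq qmax; rewrite cst // ka -mulrA -expr2 gerDl => Sq.
have /eqP : S q = 0 by apply/eqP; rewrite eq_le Sq S0.
rewrite psumr_eq0 => [/allP /(_ i (mem_index_enum i)) /eqP|j _].
  exact: dot_eq0.
exact: dot_ge0.
Qed.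

Lemma umbilical_parallel_laplacian (a : R) :
  (forall p, M p -> dot (V p) (V p) = a) ->
  (forall p X, M p -> tangent m M p X -> nablaN m M V p X = 0) ->
  forall p, M p -> rough_laplacian m M V p = a *: trace m M p (second_form m M p).
Proof.
move=> Va NV; apply: (rough_laplacian_scalar smM) => q X Mq tX.
by rewrite (nablaS_normal_field unitM smM nV Mq tX) NV // addr0 umbV // Va.
Qed.

End BiharmonicNormalFields.

(** A nonzero mean curvature excludes m = 0, where m^-1 is 0. *)
Lemma mean_curvature_trace (R : realType) (N m : nat) (M : set 'rV[R]_N) p :
  mean_curvature m M p != 0 ->
  trace m M p (second_form m M p) = m%:R *: mean_curvature m M p.
Proof.
rewrite /mean_curvature; move: (trace m M p _) => T.
rewrite scaler_eq0 negb_or invr_eq0 => /andP [m0 _].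
by rewrite scalerA divff // scale1r.
Qed.

(** A field vanishing on M has zero covariant derivatives: this is
    [rough_laplacian_scalar] for the factor 0. *)
Lemma harmonic_biharmonic (R : realType) (N m : nat) (M : set 'rV[R]_N) (k : R) :
  submanifold m M -> harmonic_submanifold m M -> biharmonic_submanifold m M k.
Proof.
move=> smM hM p Mp; rewrite (hM p Mp) !scaler0 subr0 addr0.
rewrite (rough_laplacian_scalar smM (a := 0)) ?scale0r // => q X Mq tX.
by rewrite (nablaS_eq0 smM hM Mq tX) scale0r oppr0.
Qed.

Theorem proposition1p3 (R : realType) (n m : nat) (M : set 'rV[R]_n.+1) (k : R)
  (hM : compact_submanifold_of_sphere m M) :
  (m%:R < k -> (biharmonic_submanifold m M k <-> harmonic_submanifold m M)) /\
  (m%:R * (1 - inf [set enorm (mean_curvature m M p) ^+ 2 | p in M]) <= k ->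
   k < m%:R ->
   pseudo_umbilical m M ->
   (properly_biharmonic_submanifold m M k <->
    parallel_mean_curvature m M /\
    exists c : R, [/\ c != 0,
      (forall p, M p -> enorm (mean_curvature m M p) = c)
      & k = m%:R * (1 - c ^+ 2)])).
Proof.
have [M0 sM cM smM] := hM.
have unitM p : M p -> dot p p = 1.
  by move=> /sM pS; rewrite -sqr_enorm (_ : enorm p = 1) ?expr1n.
have nH := mean_curvature_smooth_normal (m := m) unitM.
split=> [mk|infk km umb].
  split=> [bM|hH]; last exact: harmonic_biharmonic.
  exact: (biharmonic_field_eq0 unitM smM nH M0 cM mk bM).
have umbH p X : M p -> tangent m M p X ->
    weingarten m M p (mean_curvature m M p) X =
    dot (mean_curvature m M p) (mean_curvature m M p) *: X.
  by move=> Mp tX; rewrite (umb p X Mp tX) sqr_enorm.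
split=> [[bM nhM]|[par [c [c0 Hc kc]]]].
  have kf p : M p -> m%:R - k <=
      m%:R * dot (mean_curvature m M p) (mean_curvature m M p).
    move=> Mp; have infp : inf [set enorm (mean_curvature m M q) ^+ 2 | q in M]
        <= dot (mean_curvature m M p) (mean_curvature m M p).
      rewrite -sqr_enorm; apply: ge_inf; last by exists p.
      by exists 0 => _ [q _ <-]; rewrite sqr_ge0.
    rewrite lerBlDr -lerBlDl; apply: le_trans infk.
    rewrite -{1}[m%:R]mulr1 -mulrBr; apply: ler_wpM2l; first exact: ler0n.
    by rewrite lerB.
  have nz : exists2 p, M p & mean_curvature m M p != 0.
    apply: contrapT => nz; apply: nhM => p Mp; apply: contrapT => /eqP Hp.
    by apply: nz; exists p.
  have [a [a0 Ha ka NH]] :=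
    biharmonic_umbilical_parallel unitM smM nH umbH M0 cM km kf bM nz.
  split; first exact: NH.
  exists (Num.sqrt a); split.
  - by rewrite sqrtr_eq0 -ltNge.
  - by move=> p Mp; rewrite /enorm Ha.
  - by rewrite sqr_sqrtr // ltW.
have Ha p : M p -> dot (mean_curvature m M p) (mean_curvature m M p) = c ^+ 2.
  by move=> Mp; rewrite -sqr_enorm Hc.
have Hnz p : M p -> mean_curvature m M p != 0.
  move=> Mp; apply: contraNneq c0 => Hp.
  by rewrite -sqrf_eq0 -(Ha p Mp) Hp dot0l.
split; last first.
  have [p Mp] := M0; move=> hH; have := Hnz p Mp.
  by rewrite (hH p Mp) eqxx.
move=> p Mp.
rewrite (umbilical_parallel_laplacian unitM smM nH umbH Ha par Mp).
rewrite mean_curvature_trace; last exact: Hnz.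
move: (mean_curvature m M p) => h.
by rewrite scalerA -scalerBl -scalerDl kc mulrBr mulr1 addrA subrK mulrC subrr scale0r.
Qed.
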